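(* Let $m \ge n \ge 3$ be integers. If $(n,m)\neq (3,3)$ and $(n,m)\neq(3,4)$, then $$R(P_3,P_n,P_m)=m+\left\lfloor \frac{n}{2}\right\rfloor-1.$$ Moreover, $R(P_3,P_3,P_3)=R(P_3,P_3,P_4)=5$.
   Context: All graphs are finite, simple and undirected. $P_k$ denotes the path on $k$ vertices (so $P_3$ has three vertices and two edges), and $K_N$ is the complete graph on $N$ vertices. For graphs $G_1,\dots,G_t$, the multicolor Ramsey number $R(G_1,\dots,G_t)$ is the smallest positive integer $N$ such that whenever the edges of $K_N$ are partitioned into $t$ disjoint color classes (possibly empty) giving $t$ graphs $H_1,\dots,H_t$, at least one $H_i$ has a (not necessarily induced) subgraph isomorphic to $G_i$. *)

(* Defs.v *)
From mathcomp Require Import all_boot.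

Set Implicit Arguments.
Unset Strict Implicit.
Unset Printing Implicit Defensive.

Record sgraph (V : finType) := SGraph {
  adj :> rel V;
  adj_sym : symmetric adj;
  adj_irrefl : irreflexive adj
}.

Lemma complete_sym n : symmetric (fun x y : 'I_n => x != y).
Proof. by move=> x y; rewrite eq_sym. Qed.

Lemma complete_irrefl n : irreflexive (fun x y : 'I_n => x != y).
Proof. by move=> x; rewrite eqxx. Qed.

Definition complete_graph n : sgraph 'I_n :=
  SGraph (@complete_sym n) (@complete_irrefl n).

Definition consecutive k : rel 'I_k :=
  fun x y => (x.+1 == y :> nat) || (y.+1 == x :> nat).

Lemma consecutive_sym k : symmetric (@consecutive k).
Proof. by move=> x y; rewrite /consecutive orbC. Qed.

Lemma consecutive_irrefl k : irreflexive (@consecutive k).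
Proof. by move=> x; rewrite /consecutive orbb gtn_eqF. Qed.

(* The parameter k counts vertices, not edges. *)
Definition path_graph k : sgraph 'I_k :=
  SGraph (@consecutive_sym k) (@consecutive_irrefl k).

(* Subgraphs are not necessarily induced: only adjacency is preserved. *)
Definition has_copy (V W : finType) (G : sgraph V) (H : sgraph W) : Prop :=
  exists2 f : V -> W, injective f & forall x y, G x y -> H (f x) (f y).

(* Each H i is spanning, so a color class may have no edge. *)
Definition edge_partition (W : finType) (t : nat)
    (K : sgraph W) (H : 'I_t -> sgraph W) : Prop :=
  (forall x y, K x y <-> exists i, H i x y) /\
  (forall i j x y, H i x y -> H j x y -> i = j).

Definition arrows (t : nat) (V : 'I_t -> finType)
    (G : forall i, sgraph (V i)) (N : nat) : Prop :=
  forall H : 'I_t -> sgraph 'I_N,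
    edge_partition (complete_graph N) H -> exists i, has_copy (G i) (H i).

(* R(G_1, ..., G_t) = N, without presupposing that the minimum exists. *)
Definition is_ramsey_number (t : nat) (V : 'I_t -> finType)
    (G : forall i, sgraph (V i)) (N : nat) : Prop :=
  [/\ 0 < N, arrows G N & forall M, 0 < M -> arrows G M -> N <= M].

Definition path_graphs (t : nat) (ks : t.-tuple nat) (i : 'I_t) :
    sgraph 'I_(tnth ks i) :=
  path_graph (tnth ks i).

(* Main.v *)
Require Import Defs.
From mathcomp Require Import all_boot zify.

Set Implicit Arguments.
Unset Strict Implicit.
Unset Printing Implicit Defensive.

(** The theorem is proved for a complete graph whose edges are red, blue or
    green, where green has no P_3 and so is a matching; the claim is that
    N = m + n/2 - 1 >= 5 vertices, 3 <= n <= m, force a red P_n or a blue P_m.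

    Upper bound.  Induction on n + m gives a blue path X on m - 1 vertices: it
    comes from (n, m - 1) if n < m, and, after red and blue are exchanged, from
    (n - 1, n) if n = m.  At least b = n/2 vertices lie outside X; fix
    a set Y of b of them.  If there is no blue P_m, then a vertex of Y is not
    blue to an end of X, nor to both of two consecutive vertices of X, since it
    could be added to X.  Cut the interior of X into consecutive pairs {u, v}.
    Without green edges every vertex of Y would be red to u or to v, so among
    three vertices of Y two would have a common red neighbour in the pair.  One
    starts from the b vertices of Y as one-vertex red segments and merges two
    segments through one vertex of an unused pair while at least three are left;
    finally the ends of X, red to all of Y, join the last two segments and
    extend the result.  The path so obtained alternates between Y and X and has
    the required 2b or 2b + 1 vertices.

    The green matching spoils this in a controlled way.  A vertex of Y that is
    red to neither u nor v is green to one of them and blue to the other, so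
    only two vertices of Y can be lost to a pair, and those are red to
    everything that they are not blue to elsewhere, in particular to both ends
    of X.  With five segments a merge is always possible; with four, one of two
    pairs works, unless all four segments are single vertices (merge_one,
    link_four_singletons); three segments are linked directly with the help of
    the ends of X (join_three, join_three_long).  An end of X can miss one
    vertex of Y only, whence swap_ends: two distinct vertices of Y can always be
    joined to the two ends of X, in one order or in the other.  The cases b = 1
    (blue_path_matchings) and b = 2 (red_path_two_outside,
    red_path_two_outside_long) are treated apart; for b = 2 one also uses red
    edges inside Y and inside X, which exist because otherwise X could be
    rerouted to a longer blue path.

    Lower bound.  On m + n/2 - 2 vertices colour red all edges that meet a fixed
    set of n/2 - 1 vertices, and blue all others.  The edges of K_4 split into
    three perfect matchings, so no colour contains a P_3; this is why 5 is the
    value in the two exceptional cases. *)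

(** * Paths as vertex sequences *)

Definition has_path (T : eqType) (e : rel T) (k : nat) : Prop :=
  exists s : seq T, [/\ uniq s, size s = k & sorted e s].

Section PathBasics.
Variables (T : eqType) (e : rel T).

Lemma has_pathW k l : l <= k -> has_path e k -> has_path e l.
Proof.
move=> le_lk [s [Us sz_s es]]; exists (take l s).
by rewrite take_uniq // size_take_min sz_s (minn_idPl le_lk) take_sorted.
Qed.

(** The paths below are assembled from reversed and concatenated pieces of a
    duplicate-free list; multiplicities turn each check that the result has no
    repeated vertex into linear arithmetic. *)
Lemma uniq_sub_count (s t : seq T) :
  uniq t -> (forall x, count_mem x s <= count_mem x t) -> uniq s.
Proof.
move=> Ut le_st; elim: s le_st => //= x s IHs le_st; apply/andP; split.
  apply/count_memPn; have := le_st x; rewrite eqxx (count_uniq_mem x Ut).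
  by case: (x \in t); lia.
by apply: IHs => y; apply: leq_trans (le_st y); apply: leq_addl.
Qed.

(** The ends a and z are explicit so that walks can be reversed and concatenated
    without default values. *)
Definition rpath (a z : T) (s : seq T) : bool :=
  if s is x :: s' then [&& x == a, path e a s' & last a s' == z] else false.

Lemma rpath1 x : rpath x x [:: x].
Proof. by rewrite /= !eqxx. Qed.

Lemma rpath_cat a b c d s t :
  rpath a b s -> e b c -> rpath c d t -> rpath a d (s ++ t).
Proof.
case: s => [|x s] //= /and3P[-> es /eqP eb] ebc.
case: t => [|y t] //= /and3P[/eqP -> et /eqP <-].
by rewrite cat_path es /= eb ebc et last_cat /= eqxx.
Qed.

Lemma rpath_sorted a z s : rpath a z s -> sorted e s.
Proof. by case: s => //= x s /and3P[/eqP -> ->]. Qed.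

Lemma mem_rpath_head a z s : rpath a z s -> a \in s.
Proof. by case: s => //= x s /and3P[/eqP ->]; rewrite mem_head. Qed.

Lemma mem_rpath_last a z s : rpath a z s -> z \in s.
Proof. by case: s => //= x s /and3P[/eqP -> _ /eqP <-]; rewrite mem_last. Qed.

Lemma rpath_neq a z s : rpath a z s -> uniq s -> 1 < size s -> a != z.
Proof.
case: s => //= x s /and3P[/eqP -> _ /eqP <-] /andP[xs _].
by case: s xs => //= y s xs _; apply: contra xs => /eqP ->; apply: mem_last.
Qed.

Lemma has_path_rpath t k a z s : rpath a z s -> uniq t -> size s = k ->
  (forall x, count_mem x s <= count_mem x t) -> has_path e k.
Proof.
move=> rs Ut sz_s le_st; exists s.
by rewrite (rpath_sorted rs) (uniq_sub_count Ut).
Qed.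

Hypothesis e_sym : symmetric e.

Lemma rpath_rev a z s : rpath a z s -> rpath z a (rev s).
Proof.
elim: s a => //= x s IHs a /and3P[/eqP -> es /eqP ez].
case: s IHs es ez => [|y s] IHs es ez; first by rewrite -ez rpath1.
case/andP: es => eay es; rewrite rev_cons -cats1.
apply: (rpath_cat (b := y) _ _ (rpath1 a)); last by rewrite e_sym.
by apply: IHs; rewrite /rpath eqxx [path _ _ _]es; apply/eqP.
Qed.

End PathBasics.

(** Counts and sizes are generalised first: the arithmetic solver would
    otherwise branch on each boolean in the context. *)
Ltac nat_lia :=
  repeat match goal with |- context [nat_of_bool ?b] =>
    let n := fresh "n" in move: (nat_of_bool b) => n end;
  repeat match goal with |- context [count ?p ?s] =>
    let n := fresh "n" in move: (count p s) => n end;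
  repeat match goal with |- context [size ?s] =>
    let n := fresh "n" in move: (size s) => n end;
  clear; lia.

Ltac count_lia :=
  let x := fresh "x" in move=> x;
  rewrite /= ?(count_cat, count_rev) /= ?(count_cat, count_rev) /=; nat_lia.

Ltac join_path R U :=
  apply: (has_path_rpath R U);
  [rewrite /= ?(size_cat, size_rev) /= ?(size_cat, size_rev) /=; nat_lia
  | count_lia].

(** * Linking red segments when green is a matching *)

(** Here e1 and e2 stand for the ends of the blue path and Y for the vertices
    outside it.  The blue edges are hidden: they are present only through what
    they force to be red or green, such as the edges from Y to e1 and e2. *)
Section Linking.
Variables (T : eqType) (red green : rel T) (Y : pred T) (e1 e2 : T).
Hypothesis red_sym : symmetric red.
Hypothesis green_sym : symmetric green.
Hypothesis green_match : forall x y z, green x y -> green x z -> y = z.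
Hypothesis Y_e1 : forall y, Y y -> red y e1 || green y e1.
Hypothesis Y_e2 : forall y, Y y -> red y e2 || green y e2.
Hypothesis e12 : e1 != e2.

Lemma green_inj x y z : green x z -> green y z -> x = y.
Proof. by rewrite green_sym (green_sym y); apply: green_match. Qed.

(** Each of c, d, e1, e2 is on one green edge at most, so the two ways of joining
    c and d to e1 and e2 cannot both be blocked. *)
Lemma swap_ends c d : Y c -> Y d -> c != d ->
  exists f f', [/\ perm_eq [:: f; f'] [:: e1; e2], red c f & red d f'].
Proof.
move=> Yc Yd cd.
have [/andP[c1 d2]|nA] := boolP (red c e1 && red d e2); first by exists e1, e2.
have [/andP[c2 d1]|nB] := boolP (red c e2 && red d e1).
  by exists e2, e1; split=> //; rewrite (perm_catC [:: e2] [:: e1]).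
exfalso; move: nA nB (Y_e1 Yc) (Y_e2 Yc) (Y_e1 Yd) (Y_e2 Yd).
case: (red c e1); case: (red c e2); case: (red d e1); case: (red d e2) => //= _ _.
all: move=> h1 h2 h3 h4.
all: try by case/eqP: e12; apply: (green_match (x := c)).
all: try by case/eqP: e12; apply: (green_match (x := d)).
all: by case/eqP: cd; apply: green_inj; eassumption.
Qed.

Lemma some_end d : Y d ->
  exists f f', perm_eq [:: f; f'] [:: e1; e2] /\ red d f.
Proof.
move=> Yd; case/orP: (Y_e1 Yd) => [|d1]; first by exists e1, e2.
exists e2, e1; rewrite (perm_catC [:: e2] [:: e1]); split=> //.
case/orP: (Y_e2 Yd) => // d2.
by case/eqP: e12; apply: green_match d1 d2.
Qed.

Lemma Y_end f f' y : perm_eq [:: f; f'] [:: e1; e2] -> Y y ->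
  (red y f || green y f) && (red y f' || green y f').
Proof.
move=> /perm_mem Pf Yy; have /= := (Pf f, Pf f'); rewrite !inE !eqxx orbT /=.
by case=> /esym/pred2P[]-> /esym/pred2P[]->; rewrite ?Y_e1 ?Y_e2.
Qed.

Lemma red_ends f f' y : perm_eq [:: f; f'] [:: e1; e2] ->
  red y e1 && red y e2 -> red y f && red y f'.
Proof.
move=> Pf /andP[y1 y2]; have := (perm_mem Pf f, perm_mem Pf f').
rewrite !inE !eqxx orbT /=.
by case=> /esym/pred2P[]-> /esym/pred2P[]->; rewrite ?y1 ?y2.
Qed.

Lemma perm_ends f f' s : perm_eq [:: f; f'] [:: e1; e2] ->
  uniq (e1 :: e2 :: s) -> uniq (f :: f' :: s).
Proof. by move=> Pf; rewrite -(perm_uniq (perm_cat Pf (perm_refl s))). Qed.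


Definition near y (p : T * T) := red y p.1 || red y p.2.

(** What survives, in terms of red and green, of the fact that y is not blue to
    both vertices of the pair p. *)
Definition hits y (p : T * T) := near y p || (green y p.1 || green y p.2).

Lemma three_green x y z p : x != y -> x != z -> y != z ->
  ~~ [&& green x p.1 || green x p.2, green y p.1 || green y p.2
       & green z p.1 || green z p.2].
Proof.
move=> xy xz yz; apply/negP=> /and3P[].
do 3![case/orP=> ?].
all: first [ case/eqP: xy; apply: green_inj; eassumption
           | case/eqP: xz; apply: green_inj; eassumption
           | case/eqP: yz; apply: green_inj; eassumption].
Qed.

Lemma uniq_neq (s t : seq T) c d : uniq (s ++ t) -> c \in s -> d \in t -> c != d.
Proof.
by rewrite cat_uniq => /and3P[_ /hasPn st _] cs /st; apply: contraNneq => <-.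
Qed.

Notation rpath := (rpath red).

Definition seg c c' C := [/\ rpath c c' C, Y c & Y c'].

Lemma seg_rev c c' C : seg c c' C -> seg c' c (rev C).
Proof. by case=> RC Yc Yc'; split=> //; apply: rpath_rev. Qed.

(** An end f of the blue path joins the segments, and the other end f' extends the
    result.  As C has two distinct ends, one of them is not green to f; the new
    path again has two distinct ends, and one of them is not green to f'. *)
Lemma join_two C c c' D d d' :
  seg c c' C -> seg d d' D -> c != c' ->
  uniq (e1 :: e2 :: C ++ D) -> has_path red (size C + size D + 2).
Proof.
move=> [RC Yc Yc'] [RD Yd Yd'] cc' U0.
have [f [f' [Pf df]]] := some_end Yd.
have {U0} U := perm_ends Pf U0.
have cd' : c != d'.
  apply: (@uniq_neq C D); rewrite ?(mem_rpath_head RC) ?(mem_rpath_last RD) //.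
  by apply: uniq_sub_count U _; count_lia.
have c'd' : c' != d'.
  apply: (@uniq_neq C D); rewrite ?(mem_rpath_last RC) ?(mem_rpath_last RD) //.
  by apply: uniq_sub_count U _; count_lia.
wlog c'f : C c c' RC Yc Yc' cc' cd' c'd' U / red c' f.
  move=> wl; case/andP: (Y_end Pf Yc') => /orP[c'f _|c'f _].
    exact: (wl _ _ _ RC).
  have cf : red c f.
    case/andP: (Y_end Pf Yc) => /orP[//|cf] _.
    by case/eqP: cc'; apply: green_inj cf c'f.
  rewrite -(size_rev C); apply: (wl _ _ _ (rpath_rev red_sym RC)) => //.
    by rewrite eq_sym.
  by apply: uniq_sub_count U _; count_lia.
have fd : red f d by rewrite red_sym.
have RCD := rpath_cat (rpath_cat RC c'f (rpath1 red f)) fd RD.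
have [_ /orP[cf'|cf']] := andP (Y_end Pf Yc).
  have R := rpath_cat (rpath1 red f') (etrans (red_sym _ _) cf') RCD.
  by join_path R U.
have d'f' : red d' f'.
  case/andP: (Y_end Pf Yd') => _ /orP[//|d'f'].
  by case/eqP: cd'; apply: green_inj cf' d'f'.
by join_path (rpath_cat RCD d'f' (rpath1 red f')) U.
Qed.

Lemma near_hits p y : near y p -> exists2 w, w \in [:: p.1; p.2] & red y w.
Proof. by case/orP; [exists p.1 | exists p.2]; rewrite // !inE eqxx ?orbT. Qed.

(** The one green edge of a vertex that is red to neither vertex of p goes to p,
    so it cannot go to e1 or e2. *)
Lemma far_ends p y : uniq [:: e1; e2; p.1; p.2] -> Y y -> hits y p ->
  ~~ near y p -> red y e1 && red y e2.
Proof.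
move=> U Yy; rewrite /hits => /orP[->//|gy] _.
have apart e w : red y e || green y e -> e != w -> green y w -> red y e.
  case/orP=> // gye ew gyw; by case/eqP: ew; apply: green_match gye gyw.
move: U; rewrite /= !inE !negb_or => /and3P[/and3P[_ a b] /andP[c d] _].
by case/orP: gy => gy; rewrite (apart _ _ (Y_e1 Yy) _ gy) ?(apart _ _ (Y_e2 Yy) _ gy).
Qed.

(** The shape is w - D - f - C - f', with w in the pair p and f, f' the two ends
    of the blue path in the order given by swap_ends. *)
Lemma link_far C c c' D d d' p : rpath c c' C -> rpath d d' D -> Y c' -> Y d' ->
  red c e1 && red c e2 -> near d p -> uniq [:: e1, e2, p.1, p.2 & C ++ D] ->
  has_path red (size C + size D + 3).
Proof.
move=> RC RD Yc' Yd' /andP[c1 c2] /near_hits[w wp dw] U0.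
have d'c' : d' != c'.
  apply: (@uniq_neq D C); rewrite ?(mem_rpath_last RC) ?(mem_rpath_last RD) //.
  by apply: uniq_sub_count U0 _; count_lia.
have [f [f' [Pf d'f c'f']]] := swap_ends Yd' Yc' d'c'.
have fc : red f c.
  have := perm_mem Pf f; rewrite red_sym mem_head => /esym.
  by rewrite !inE => /pred2P[]->.
have R := rpath_cat (rpath_cat (rpath_cat (rpath_cat (rpath1 red w)
  (etrans (red_sym _ _) dw) RD) d'f (rpath1 red f)) fc RC) c'f' (rpath1 red f').
have U := perm_ends Pf U0.
by move: wp R; rewrite !inE => /pred2P[]-> R; join_path R U.
Qed.

(** The shape is f - C - w - D - f', where w is the common red neighbour. *)
Lemma link_shared C c c' D d d' w : rpath c c' C -> rpath d d' D ->
  Y c -> Y d' -> red c' w -> red d w -> uniq [:: e1, e2, w & C ++ D] ->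
  has_path red (size C + size D + 3).
Proof.
move=> RC RD Yc Yd' c'w dw U0.
have cd' : c != d'.
  apply: (@uniq_neq C D); rewrite ?(mem_rpath_head RC) ?(mem_rpath_last RD) //.
  by apply: uniq_sub_count U0 _; count_lia.
have [f [f' [Pf cf d'f']]] := swap_ends Yc Yd' cd'.
have R := rpath_cat (rpath_cat (rpath_cat (rpath_cat (rpath1 red f)
  (etrans (red_sym _ _) cf) RC) c'w (rpath1 red w)) (etrans (red_sym _ _) dw) RD)
  d'f' (rpath1 red f').
by join_path R (perm_ends Pf U0).
Qed.

(** The shape is u - C - f - D - v. *)
Lemma link_crossed C c c' D d d' u v f : rpath c c' C -> rpath d d' D ->
  red c u -> red d' v -> red c' f -> red d f -> uniq [:: f, u, v & C ++ D] ->
  has_path red (size C + size D + 3).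
Proof.
move=> RC RD cu d'v c'f df U.
have R := rpath_cat (rpath_cat (rpath_cat (rpath_cat (rpath1 red u)
  (etrans (red_sym _ _) cu) RC) c'f (rpath1 red f)) (etrans (red_sym _ _) df) RD)
  d'v (rpath1 red v).
by join_path R U.
Qed.

(** At most two vertices of Y are green to the pair.  So if c is red to neither
    vertex of p and both ends of D are not either, then D is a single vertex
    and the other end of C is red to a vertex of p: the segments exchange roles. *)
Lemma join_far C c c' D d d' p :
  (forall y, Y y -> hits y p) -> seg c c' C -> seg d d' D ->
  (c != c') || (d != d') -> ~~ near c p ->
  uniq [:: e1, e2, p.1, p.2 & C ++ D] -> has_path red (size C + size D + 3).
Proof.
move=> hitsp [RC Yc Yc'] [RD Yd Yd'] ccdd cF U.
have Up : uniq [:: e1; e2; p.1; p.2] by apply: uniq_sub_count U _; count_lia.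
have RC' := rpath_rev red_sym RC; have RD' := rpath_rev red_sym RD.
have UCD : uniq (C ++ D) by apply: uniq_sub_count U _; count_lia.
have c12 := far_ends Up Yc (hitsp _ Yc) cF.
have [dN|dF] := boolP (near d p); first exact: link_far RC RD _ _ c12 dN U.
have [d'N|d'F] := boolP (near d' p).
  rewrite -(size_rev D); apply: link_far RC RD' _ _ c12 d'N _ => //.
  by apply: uniq_sub_count U _; count_lia.
have far3 x y z : Y x -> Y y -> Y z -> x != y -> x != z -> y != z ->
    ~~ near x p -> ~~ near y p -> near z p.
  move=> /hitsp /orP[->//|gx] /hitsp /orP[->//|gy] /hitsp /orP[//|gz] xy xz yz.
  by have := three_green p xy xz yz; rewrite gx gy gz.
have cd : c != d.
  by apply: (uniq_neq UCD); rewrite ?(mem_rpath_head RC) ?(mem_rpath_head RD).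
have cd' : c != d'.
  by apply: (uniq_neq UCD); rewrite ?(mem_rpath_head RC) ?(mem_rpath_last RD).
have c'd : c' != d.
  by apply: (uniq_neq UCD); rewrite ?(mem_rpath_last RC) ?(mem_rpath_head RD).
have dd' : d == d' by apply: contraNT d'F => dd'; apply: (far3 c d).
have cc' : c != c' by move: ccdd; rewrite dd' orbF.
have c'N : near c' p by apply: (far3 c d) => //; rewrite eq_sym.
have d12 := far_ends Up Yd (hitsp _ Yd) dF.
rewrite (addnC (size C)) -(size_rev C).
by apply: link_far RD RC' _ _ d12 c'N _ => //; apply: uniq_sub_count U _; count_lia.
Qed.

(** One vertex more than in join_two, at the price of an unused pair.  If all four
    segment ends are red to a vertex of p and no vertex of p serves both
    segments, then C sees one vertex of p from both ends and D the other one from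
    both ends, so p extends the path on both sides of the join. *)
Lemma join_two_long C c c' D d d' p :
  (forall y, Y y -> hits y p) -> seg c c' C -> seg d d' D -> c != c' ->
  uniq [:: e1, e2, p.1, p.2 & C ++ D] -> has_path red (size C + size D + 3).
Proof.
move=> hitsp SC SD cc' U; have [SC' SD'] := (seg_rev SC, seg_rev SD).
have [cN|cF] := boolP (near c p); last first.
  by apply: join_far SC SD _ cF U; rewrite ?cc'.
have [c'N|c'F] := boolP (near c' p); last first.
  rewrite -(size_rev C); apply: join_far SC' SD _ c'F _ => //.
    by rewrite eq_sym cc'.
  by apply: uniq_sub_count U _; count_lia.
have [dN|dF] := boolP (near d p); last first.
  rewrite (addnC (size C)); apply: join_far SD SC _ dF _ => //.
    by rewrite cc' orbT.
  by apply: uniq_sub_count U _; count_lia.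
have [d'N|d'F] := boolP (near d' p); last first.
  rewrite (addnC (size C)) -(size_rev D); apply: join_far SD' SC _ d'F _ => //.
    by rewrite cc' orbT.
  by apply: uniq_sub_count U _; count_lia.
case: SC SD SC' SD' => RC Yc Yc' [RD Yd Yd'] [RC' _ _] [RD' _ _].
have share x y w : x \in [:: c; c'] -> y \in [:: d; d'] -> w \in [:: p.1; p.2] ->
    red x w -> red y w -> has_path red (size C + size D + 3).
  rewrite !inE => /pred2P[]-> /pred2P[]-> wp xw yw.
  - rewrite -(size_rev C); apply: link_shared RC' RD _ _ xw yw _ => //.
    by case/pred2P: wp => ->; apply: uniq_sub_count U _; count_lia.
  - rewrite -(size_rev C) -(size_rev D); apply: link_shared RC' RD' _ _ xw yw _ => //.
    by case/pred2P: wp => ->; apply: uniq_sub_count U _; count_lia.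
  - apply: link_shared RC RD _ _ xw yw _ => //.
    by case/pred2P: wp => ->; apply: uniq_sub_count U _; count_lia.
  - rewrite -(size_rev D); apply: link_shared RC RD' _ _ xw yw _ => //.
    by case/pred2P: wp => ->; apply: uniq_sub_count U _; count_lia.
have [f [f' [Pf df]]] := some_end Yd.
have {}U := perm_ends Pf U.
have mem2 (x y : T) : (x \in [:: x; y]) * (y \in [:: x; y]).
  by rewrite !inE !eqxx orbT.
wlog cu : p U {cN c'N dN d'N hitsp} share cN c'N dN d'N / red c p.1.
  move=> wl; have [cu|cu] := boolP (red c p.1); first exact: wl cu.
  have cv : red c p.2 by move: cN; rewrite /near (negPf cu).
  apply: (wl (p.2, p.1)) cv; try by rewrite /near orbC.
    by apply: uniq_sub_count U _; count_lia.
  by move=> x y w xc yd wp; apply: share; rewrite // !inE orbC -!mem_seq1 in wp *.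
have [du|du] := boolP (red d p.1); first by apply: share cu du; rewrite !mem2.
have [d'u|d'u] := boolP (red d' p.1); first by apply: share cu d'u; rewrite !mem2.
move: dN d'N; rewrite /near (negPf du) (negPf d'u) /= => dv d'v.
have [cv|cv] := boolP (red c p.2); first by apply: share cv dv; rewrite !mem2.
have [c'v|c'v] := boolP (red c' p.2); first by apply: share c'v dv; rewrite !mem2.
move: c'N; rewrite /near (negPf c'v) orbF => c'u.
case/andP: (Y_end Pf Yc') => /orP[c'f|c'f] _.
  by apply: link_crossed RC RD cu d'v c'f df _; apply: uniq_sub_count U _; count_lia.
case/andP: (Y_end Pf Yc) => /orP[cf|cf] _.
  rewrite -(size_rev C); apply: link_crossed RC' RD c'u d'v cf df _.
  by apply: uniq_sub_count U _; count_lia.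
by case/eqP: cc'; apply: green_inj cf c'f.
Qed.

(** A vertex can lose only one pair to its green edge. *)
Lemma far_near p q y : uniq [:: p.1; p.2; q.1; q.2] -> hits y p -> hits y q ->
  ~~ near y p -> near y q.
Proof.
move=> U /orP[->//|gp] /orP[//|gq] _.
have apart u v : green y u -> green y v -> u != v -> near y q.
  by move=> gu gv; rewrite (green_match gu gv) eqxx.
move: U; rewrite /= !inE !negb_or.
case/and3P=> /and3P[_ a b] /andP[c d] _.
by case/orP: gp => gp; case/orP: gq => gq; apply: apart gp gq _.
Qed.

(** A segment that misses the pair p can be put in the middle, as its ends are red
    to both ends of the blue path: w - C - f - Z - f' - D. *)
Lemma link_three_far Z z z' C c c' D d d' p :
  seg z z' Z -> seg c c' C -> seg d d' D ->
  red z e1 && red z e2 -> red z' e1 && red z' e2 -> near c p ->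
  uniq [:: e1, e2, p.1, p.2 & Z ++ C ++ D] ->
  has_path red (size Z + size C + size D + 3).
Proof.
move=> [RZ Yz Yz'] [RC Yc Yc'] [RD Yd Yd'] zE z'E /near_hits[w wp cw] U0.
have c'd : c' != d.
  apply: (@uniq_neq C D); rewrite ?(mem_rpath_last RC) ?(mem_rpath_head RD) //.
  by apply: uniq_sub_count U0 _; count_lia.
have [f [f' [Pf c'f df']]] := swap_ends Yc' Yd c'd.
have [zf _] := andP (red_ends Pf zE); have [_ z'f'] := andP (red_ends Pf z'E).
have R := rpath_cat (rpath_cat (rpath_cat (rpath_cat (rpath_cat (rpath1 red w)
  (etrans (red_sym _ _) cw) RC) c'f (rpath1 red f)) (etrans (red_sym _ _) zf) RZ)
  z'f' (rpath1 red f')) (etrans (red_sym _ _) df') RD.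
have U := perm_ends Pf U0.
by move: wp R; rewrite !inE => /pred2P[]-> R; join_path R U.
Qed.

(** Z misses p, hence it reaches q, and W misses q, hence it reaches p.  The
    shape is a - Z - f - X - f' - W - b, with a in q and b in p.  It fails only
    if X is a single vertex x, green to an end f' of the blue path; then x
    reaches p, and the shape is e - x - f - W - f' - Z - a'. *)
Lemma link_three_far_long Z z z' W w w' X x x' p q :
  (forall y, Y y -> hits y p) -> (forall y, Y y -> hits y q) ->
  seg z z' Z -> seg w w' W -> seg x x' X ->
  ~~ near z p -> ~~ near z' p -> ~~ near w q -> ~~ near w' q ->
  uniq [:: e1, e2, p.1, p.2, q.1, q.2 & Z ++ W ++ X] ->
  has_path red (size Z + size W + size X + 4).
Proof.
move=> hp hq [RZ Yz Yz'] [RW Yw Yw'] [RX Yx Yx'] zp z'p wq w'q U0.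
have Up : uniq [:: e1; e2; p.1; p.2] by apply: uniq_sub_count U0 _; count_lia.
have Uq : uniq [:: e1; e2; q.1; q.2] by apply: uniq_sub_count U0 _; count_lia.
have Upq : uniq [:: p.1; p.2; q.1; q.2] by apply: uniq_sub_count U0 _; count_lia.
have Uqp : uniq [:: q.1; q.2; p.1; p.2] by apply: uniq_sub_count U0 _; count_lia.
have zE := far_ends Up Yz (hp _ Yz) zp; have z'E := far_ends Up Yz' (hp _ Yz') z'p.
have wE := far_ends Uq Yw (hq _ Yw) wq; have w'E := far_ends Uq Yw' (hq _ Yw') w'q.
have [a aq za] := near_hits (far_near Upq (hp _ Yz) (hq _ Yz) zp).
have [a' a'q za'] := near_hits (far_near Upq (hp _ Yz') (hq _ Yz') z'p).
have [b bp wb] := near_hits (far_near Uqp (hq _ Yw') (hp _ Yw') w'q).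
have middle f f' : perm_eq [:: f; f'] [:: e1; e2] -> red x f -> red x' f' ->
    has_path red (size Z + size W + size X + 4).
  move=> Pf xf xf'.
  have [z'f _] := andP (red_ends Pf z'E).
  have [_ wf'] := andP (red_ends Pf wE).
  have R := rpath_cat (rpath_cat (rpath_cat (rpath_cat (rpath_cat (rpath_cat
    (rpath1 red a) (etrans (red_sym _ _) za) RZ) z'f (rpath1 red f))
    (etrans (red_sym _ _) xf) RX) xf' (rpath1 red f'))
    (etrans (red_sym _ _) wf') RW) wb (rpath1 red b).
  have U := perm_ends Pf U0.
  by move: aq bp R; rewrite !inE => /pred2P[]-> /pred2P[]-> R; join_path R U.
have [xx'|xx'] := eqVneq x x'; last first.
  by have [f [f' [Pf xf x'f']]] := swap_ends Yx Yx' xx'; apply: middle Pf xf x'f'.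
have [f [f' [Pf xf]]] := some_end Yx.
have [_ /orP[xf'|gxf']] := andP (Y_end Pf Yx).
  by apply: middle Pf xf _; rewrite -xx'.
have U := perm_ends Pf U0.
have xp : near x p.
  case/orP: (hp _ Yx) => // gx; move: U.
  by case/orP: gx => /(green_match gxf') ->; rewrite /= !inE !eqxx ?orbT /= ?andbF.
have [e ep xe] := near_hits xp.
have [fw f'w'] : red f w /\ red w' f'.
  by rewrite red_sym; case/andP: (red_ends Pf wE); case/andP: (red_ends Pf w'E).
have f'z : red f' z by rewrite red_sym; case/andP: (red_ends Pf zE).
have R := rpath_cat (rpath_cat (rpath_cat (rpath_cat (rpath_cat (rpath_cat
  (rpath1 red e) (etrans (red_sym _ _) xe) RX) (etrans (congr1 (red^~ f) (esym xx')) xf)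
  (rpath1 red f)) fw RW) f'w' (rpath1 red f')) f'z RZ) za' (rpath1 red a').
by move: a'q ep R; rewrite !inE => /pred2P[]-> /pred2P[]-> R; join_path R U.
Qed.

Definition segs (L : seq (seq T)) := forall C, C \in L -> exists c c', seg c c' C.
Definition free p C := near (head e1 C) p || near (last e1 C) p.

Lemma segs_cons C L : segs (C :: L) -> segs L.
Proof. by move=> sL B BL; apply: sL; rewrite inE BL orbT. Qed.

Lemma rpath_ends c c' C : rpath c c' C -> (head e1 C = c) * (last e1 C = c').
Proof. by case: C => //= x C /and3P[/eqP -> _ /eqP ->]. Qed.

Lemma not_free p C c c' : seg c c' C -> ~~ free p C -> ~~ near c p /\ ~~ near c' p.
Proof. by case=> RC _ _; rewrite /free !(rpath_ends RC) => /norP. Qed.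

Lemma perm_segs L L' : perm_eq L L' -> segs L -> segs L'.
Proof. by move=> /perm_mem PL sL C; rewrite -PL; apply: sL. Qed.

Lemma free_end p C c c' : seg c c' C -> free p C ->
  exists x x' C', [/\ seg x' x C', seg x x' (rev C'), near x p & perm_eq C' C].
Proof.
move=> SC; have [RC _ _] := SC; rewrite /free !(rpath_ends RC).
case/orP=> nC.
  exists c, c', (rev C); rewrite revK perm_rev; split=> //; exact: seg_rev.
by exists c', c, C; split=> //; apply: seg_rev.
Qed.

Definition merged p L L' := [/\ segs L', size L = (size L').+1,
  exists2 w, w \in [:: p.1; p.2] & perm_eq (flatten L') (w :: flatten L)
  & has (fun C => 1 < size C) L'].

Lemma merge_shared p L R A B x x' y y' w : perm_eq L (A :: B :: R) -> segs L ->
  (exists2 A', seg x' x A' & perm_eq A' A) ->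
  (exists2 B', seg y y' B' & perm_eq B' B) ->
  w \in [:: p.1; p.2] -> red x w -> red y w -> exists L', merged p L L'.
Proof.
move=> PL sL [A' SA PA] [B' SB PB] wp xw yw.
exists ((A' ++ w :: B') :: R); split.
- have sR := perm_segs PL sL.
  move=> C; rewrite inE => /predU1P[->|CR]; last by apply: sR; rewrite !inE CR !orbT.
  case: SA SB => RA Yx' Yx [RB Yy Yy']; exists x', y'; split=> //.
  by apply: (rpath_cat RA xw (rpath_cat (rpath1 red w) _ RB)); rewrite red_sym.
- by rewrite (perm_size PL).
- exists w => //; apply/permP => a; rewrite /= (permP (perm_flatten PL)) /=.
  rewrite !count_cat /= (permP PA) (permP PB); nat_lia.
- by case: SA => /mem_rpath_head; case: A' {PA} => //= ? ? _; rewrite size_cat /= addnS.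
Qed.

(** Pigeonhole: of three segments with an end that is red to one of the two
    vertices of p, two use the same vertex. *)
Lemma merge_three p L : segs L -> 2 < count (free p) L -> exists L', merged p L L'.
Proof.
move=> sL; rewrite -size_filter.
have : perm_eq L (filter (free p) L ++ filter (predC (free p)) L).
  by rewrite perm_sym perm_filterC.
have := mem_filter (free p) ^~ L.
case: (filter _ _) => [|A [|B [|C F]]] //= memF PL _.
set R := filter _ _ in PL.
have fr X : X \in [:: A, B, C & F] -> exists x x' X',
    [/\ seg x' x X', seg x x' (rev X'), near x p & perm_eq X' X].
  by rewrite memF => /andP[fX /sL[c [c' SX]]]; apply: free_end SX fX.
have [a [a' [A' [SA SA' na PA]]]] := fr A (mem_head _ _).
have [|b [b' [B' [SB SB' nb PB]]]] := fr B; first by rewrite !inE eqxx orbT.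
have [|c [c' [C' [SC SC' nc PC]]]] := fr C; first by rewrite !inE eqxx !orbT.
have P1 : perm_eq L [:: A, B, C & F ++ R] by [].
have P2 : perm_eq L [:: A, C, B & F ++ R].
  by apply: perm_trans P1 _; rewrite perm_cons (perm_catCA [:: B] [:: C]).
have P3 : perm_eq L [:: B, C, A & F ++ R].
  apply: perm_trans P1 _; rewrite (perm_catCA [:: A] [:: B]) /= perm_cons.
  by rewrite (perm_catCA [:: A] [:: C]).
have rP (X X' : seq T) : perm_eq X' X -> perm_eq (rev X') X by rewrite perm_rev.
have up : p.1 \in [:: p.1; p.2] by rewrite mem_head.
have vp : p.2 \in [:: p.1; p.2] by rewrite !inE eqxx orbT.
have go X Z x x' z z' X' Z' Q w: perm_eq L [:: X, Z & Q] -> seg x' x X' ->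
  perm_eq X' X -> seg z z' (rev Z') -> perm_eq Z' Z ->
  w \in [:: p.1; p.2] -> red x w -> red z w -> exists L', merged p L L'.
  move=> PQ SX PX SZ PZ; apply: (merge_shared PQ sL (ex_intro2 _ _ X' SX PX)).
  by apply: (ex_intro2 _ _ (rev Z')) SZ (rP _ _ PZ).
case/orP: na => aw; case/orP: nb => bw; case/orP: nc => cw.
all: first [ by apply: (go _ _ _ _ _ _ _ _ _ _ P1 SA PA SB' PB _ aw bw)
           | by apply: (go _ _ _ _ _ _ _ _ _ _ P2 SA PA SC' PC _ aw cw)
           | by apply: (go _ _ _ _ _ _ _ _ _ _ P3 SB PB SC' PC _ bw cw)].
Qed.

Definition nontriv (C : seq T) := 1 < size C.
Definition pair_vertices (Ps : seq (T * T)) := flatten [seq [:: p.1; p.2] | p <- Ps].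

Lemma green_count p s : uniq s ->
  count (fun y => green y p.1 || green y p.2) s <= 2.
Proof.
move=> Us; rewrite -size_filter; have := filter_uniq (fun y => green y p.1 || green y p.2) Us.
have := mem_filter (fun y => green y p.1 || green y p.2) ^~ s.
case: (filter _ _) => [|x [|y [|z t]]] //= memF.
rewrite !inE !negb_or => /and4P[/and3P[xy xz _] /andP[yz _] _ _].
have gr w : w \in [:: x, y, z & t] -> green w p.1 || green w p.2.
  by rewrite memF => /andP[].
by have := three_green p xy xz yz; rewrite !gr // !inE eqxx ?orbT.
Qed.

Lemma perm_pair_vertices Ps Ps' : perm_eq Ps Ps' ->
  perm_eq (pair_vertices Ps) (pair_vertices Ps').
Proof. by move=> PP; apply/perm_flatten/perm_map. Qed.

(** A segment that is not free takes up a green edge into p for each of its ends,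
    hence two if it has more than one vertex; p receives two green edges. *)
Lemma far_count L p : (forall y, Y y -> hits y p) -> segs L -> uniq (flatten L) ->
  count (predC (free p)) L + count (fun C => ~~ free p C && nontriv C) L <= 2.
Proof.
move=> hp sL UL; apply: leq_trans (green_count p UL).
elim: L sL UL => //= C L IHL sL; rewrite cat_uniq count_cat => /and3P[UC _ UL].
have {}IHL := IHL (segs_cons sL) UL.
have [c [c' [RC Yc Yc']]] := sL C (mem_head _ _).
suff: ~~ free p C + (~~ free p C && nontriv C) <= count (fun y => green y p.1 || green y p.2) C.
  by move: IHL; nat_lia.
have [//|/=] := boolP (free p C).
rewrite /free !(rpath_ends RC) negb_or => /andP[cF c'F].
have gr y : Y y -> ~~ near y p -> green y p.1 || green y p.2.
  by move=> /hp /orP[->|].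
rewrite -size_filter; have [cc'|cc'] := boolP (nontriv C).
  apply: (@uniq_leq_size _ [:: c; c']).
    by rewrite /= inE andbT; apply: rpath_neq RC UC cc'.
  move=> y; rewrite !inE mem_filter => /pred2P[]->.
    by rewrite gr // (mem_rpath_head RC).
  by rewrite gr // (mem_rpath_last RC).
rewrite -has_predT; apply/hasP; exists c => //.
by rewrite mem_filter gr // (mem_rpath_head RC).
Qed.

(** If neither pair allows a merge, each has at most two free segments, hence
    exactly two segments that are not free and thus are single vertices.  A
    vertex misses one pair at most, so these account for all four segments. *)
Lemma merge_one L p q : (forall y, Y y -> hits y p) -> (forall y, Y y -> hits y q) ->
  segs L -> uniq [:: p.1, p.2, q.1, q.2 & flatten L] -> 3 < size L ->
  [\/ exists L', merged p L L', exists L', merged q L L'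
    | [/\ size L = 4, count (free p) L = 2, ~~ has nontriv L
      & forall C, C \in L -> free q C = ~~ free p C]].
Proof.
move=> hp hq sL U sz_L.
have UL : uniq (flatten L) by apply: uniq_sub_count U _; count_lia.
have Upq : uniq [:: p.1; p.2; q.1; q.2] by apply: uniq_sub_count U _; count_lia.
have [/(merge_three sL)|p2] := ltnP 2 (count (free p) L); first by constructor 1.
have [/(merge_three sL)|q2] := ltnP 2 (count (free q) L); first by constructor 2.
constructor 3.
have := (far_count hp sL UL, far_count hq sL UL).
have := (count_predC (free p) L, count_predC (free q) L).
have pq C : C \in L -> free p C || free q C.
  case/sL=> c [c' [RC Yc _]]; rewrite /free !(rpath_ends RC).
  have [//|/= cF] := boolP (near c p).
  by rewrite (far_near Upq (hp _ Yc) (hq _ Yc) cF) orbT.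
case=> cp cq [fp fq].
have sz4 : size L = 4 by move: sz_L p2 q2 cp cq fp fq; clear; lia.
have p2' : count (free p) L = 2 by move: sz_L p2 q2 cp cq fp fq; clear; lia.
have q2' : count (free q) L = 2 by move: sz_L p2 q2 cp cq fp fq; clear; lia.
have pL : count (fun C => ~~ free p C && nontriv C) L = 0.
  by move: sz_L p2 q2 cp cq fp fq; clear; lia.
have qL : count (fun C => ~~ free q C && nontriv C) L = 0.
  by move: sz_L p2 q2 cp cq fp fq; clear; lia.
have both : count (predI (free p) (free q)) L = 0.
  have := count_predUI (free p) (free q) L.
  have -> : count (predU (free p) (free q)) L = size L.
    by apply/eqP; rewrite -all_count; apply/allP => C /pq.
  by rewrite p2' q2' sz4 => /addnI.
have qp C : C \in L -> free q C = ~~ free p C.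
  move=> CL; have := pq C CL; move/eqP: both; rewrite -leqn0 leqNgt -has_count.
  by move/hasPn/(_ _ CL) => /=; case: (free p C); case: (free q C).
split=> //; apply/hasPn => C CL; apply/negP => lC.
have := qp C CL; move/eqP: pL; rewrite -leqn0 leqNgt -has_count => /hasPn/(_ _ CL).
move/eqP: qL; rewrite -leqn0 leqNgt -has_count => /hasPn/(_ _ CL) /=.
by rewrite lC !andbT !negbK => -> ->.
Qed.

Lemma perm_extract_two (L : seq (seq T)) C Z : size L = 3 -> C \in L -> Z \in L ->
  C != Z -> exists D, perm_eq L [:: C; Z; D].
Proof.
move=> sz_L CL ZL CZ.
have PC := perm_to_rem CL; have ZR : Z \in rem C L.
  by move: ZL; rewrite (perm_mem PC) inE eq_sym (negPf CZ).
have PZ := perm_to_rem ZR; have : size (rem Z (rem C L)) = 1.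
  by have := perm_size PC; rewrite sz_L /= (perm_size PZ) => -[].
case E: (rem Z (rem C L)) => [|D [|]] // _; exists D.
by apply: perm_trans PC _; rewrite perm_cons -E.
Qed.

Lemma two_segs L : segs L -> size L = 2 -> has nontriv L -> uniq (flatten L) ->
  exists A B a a' b b', [/\ seg a a' A, seg b b' B, a != a' & perm_eq L [:: A; B]].
Proof.
case: L => [|A [|B []]] //= sL _ lL; rewrite cats0 cat_uniq => /and3P[UA _ UB].
have [a [a' SA]] := sL A (mem_head _ _).
have [|b [b' SB]] := sL B; first by rewrite !inE eqxx orbT.
have [[RA _ _] [RB _ _]] := (SA, SB).
case/or3P: lL => // [lA|lB].
  by exists A, B, a, a', b, b'; rewrite (rpath_neq RA).
by exists B, A, b, b', a, a'; rewrite (rpath_neq RB) // (perm_catC [:: A] [:: B]).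
Qed.

(** Either two of the segments merge through p, which yields a segment with two
    distinct ends, or some segment misses p. *)
Lemma join_three L p : (forall y, Y y -> hits y p) -> segs L -> size L = 3 ->
  uniq [:: e1, e2, p.1, p.2 & flatten L] -> has_path red (size (flatten L) + 3).
Proof.
move=> hp sL sz_L U.
have UL : uniq (flatten L) by apply: uniq_sub_count U _; count_lia.
have Up : uniq [:: e1; e2; p.1; p.2] by apply: uniq_sub_count U _; count_lia.
have [/(merge_three sL)[L' [sL' sz_L' [w wp PL'] lL']]|p2] := ltnP 2 (count (free p) L).
  have -> : size (flatten L) + 3 = size (flatten L') + 2.
    by rewrite (perm_size PL') /= addSn !addnS.
  have {}U : uniq [:: e1, e2 & flatten L'].
    apply: uniq_sub_count U _ => x; rewrite /= (permP PL') /=.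
    by move: wp; rewrite !inE => /pred2P[]->; nat_lia.
  have sz2 : size L' = 2 by move: sz_L' sz_L; clear; lia.
  have [|A [B [a [a' [b [b' [SA SB aa' PAB]]]]]]] := two_segs sL' sz2 lL'.
    by apply: uniq_sub_count U _; count_lia.
  have PF := perm_flatten PAB; rewrite (perm_size PF) /= cats0 size_cat.
  apply: join_two SA SB aa' _; apply: uniq_sub_count U _ => x.
  by rewrite /= (permP PF) /= cats0.
have farL := far_count hp sL UL.
have szL := count_predC (free p) L.
have /hasP[C CL Cfree] : has (free p) L.
  by rewrite has_count; move: farL szL sz_L; clear; lia.
have /hasP[Z ZL Zfar] : has (predC (free p)) L.
  by rewrite has_count; move: p2 szL sz_L; clear; lia.
have CZ : C != Z by apply: contraNneq Zfar => <-.
have [D PL] := perm_extract_two sz_L CL ZL CZ.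
have [c [c' [C' [SC _ nc PC]]]] : exists c c' C',
    [/\ seg c c' C', seg c' c (rev C'), near c p & perm_eq C' C].
  have [c [c' SC]] := sL C CL; have [x [x' [X [_ SX nx PX]]]] := free_end SC Cfree.
  by exists x, x', (rev X); rewrite revK perm_rev; split=> //; rewrite -(revK X); apply: seg_rev.
have [z [z' SZ]] := sL Z ZL; have [RZ Yz Yz'] := SZ.
have [|d [d' SD]] := sL D; first by rewrite (perm_mem PL) !inE eqxx !orbT.
have [zF z'F] := not_free SZ Zfar.
have PF := perm_flatten PL.
rewrite (perm_size PF) /= cats0 !size_cat -(perm_size PC) addnCA addnA.
apply: link_three_far SZ SC SD (far_ends Up Yz (hp _ Yz) zF)
  (far_ends Up Yz' (hp _ Yz') z'F) nc _.
apply: uniq_sub_count U _ => x; rewrite /= (permP PF) /= cats0 !count_cat (permP PC).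
by nat_lia.
Qed.

(** A segment that misses p differs from one that misses q, by far_near. *)
Lemma join_three_long L p q :
  (forall y, Y y -> hits y p) -> (forall y, Y y -> hits y q) ->
  segs L -> size L = 3 ->
  uniq [:: e1, e2, p.1, p.2, q.1, q.2 & flatten L] -> has_path red (size (flatten L) + 4).
Proof.
move=> hp hq sL sz_L U.
have UL : uniq (flatten L) by apply: uniq_sub_count U _; count_lia.
have Up : uniq [:: e1; e2; p.1; p.2] by apply: uniq_sub_count U _; count_lia.
have Uq : uniq [:: e1; e2; q.1; q.2] by apply: uniq_sub_count U _; count_lia.
have Upq : uniq [:: p.1; p.2; q.1; q.2] by apply: uniq_sub_count U _; count_lia.
have merge_join r r' : (forall y, Y y -> hits y r') ->
    uniq [:: e1, e2, r.1, r.2, r'.1, r'.2 & flatten L] -> 2 < count (free r) L ->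
    has_path red (size (flatten L) + 4).
  move=> hr' Ur /(merge_three sL)[L' [sL' sz_L' [w wr PL'] lL']].
  have -> : size (flatten L) + 4 = size (flatten L') + 3.
    by rewrite (perm_size PL') /= addSn !addnS.
  have {}Ur : uniq [:: e1, e2, r'.1, r'.2 & flatten L'].
    apply: uniq_sub_count Ur _ => x; rewrite /= (permP PL') /=.
    by move: wr; rewrite !inE => /pred2P[]->; nat_lia.
  have sz2 : size L' = 2 by move: sz_L' sz_L; clear; lia.
  have [|A [B [a [a' [b [b' [SA SB aa' PAB]]]]]]] := two_segs sL' sz2 lL'.
    by apply: uniq_sub_count Ur _; count_lia.
  have PF := perm_flatten PAB; rewrite (perm_size PF) /= cats0 size_cat.
  apply: join_two_long hr' SA SB aa' _; apply: uniq_sub_count Ur _ => x.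
  by rewrite /= (permP PF) /= cats0.
have [/(merge_join _ _ hq U)//|p2] := ltnP 2 (count (free p) L).
have [q3|q2] := ltnP 2 (count (free q) L).
  by apply: merge_join hp _ q3; apply: uniq_sub_count U _; count_lia.
have farL r : count (free r) L <= 2 -> has (predC (free r)) L.
  rewrite has_count => r2; have := count_predC (free r) L.
  by move: r2 sz_L; clear; lia.
have /hasP[Z ZL Zfar] := farL p p2; have /hasP[W WL Wfar] := farL q q2.
have [z [z' SZ]] := sL Z ZL; have [RZ Yz Yz'] := SZ.
have [w [w' SW]] := sL W WL; have [RW Yw Yw'] := SW.
have [[zF z'F] [wF w'F]] := (not_free SZ Zfar, not_free SW Wfar).
have ZW : Z != W.
  apply: contraNneq wF => ZW; rewrite -(rpath_ends RW) -ZW (rpath_ends RZ).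
  exact: far_near Upq (hp _ Yz) (hq _ Yz) zF.
have [D PL] := perm_extract_two sz_L ZL WL ZW.
have [|d [d' SD]] := sL D; first by rewrite (perm_mem PL) !inE eqxx !orbT.
have PF := perm_flatten PL.
rewrite (perm_size PF) /= cats0 !size_cat addnA.
apply: (link_three_far_long hp hq SZ SW SD zF z'F wF w'F).
by apply: uniq_sub_count U _ => x; rewrite /= (permP PF) /= cats0; nat_lia.
Qed.

(** Merging is impossible here: y1, y2 miss p, and y3, y4 miss q.  All four are red
    to both ends of the blue path, and y1 y2 is a red edge, so that there is the
    path a - y1 - y2 - e1 - y3 - e2 - y4 - b, with a in q and b in p.  The direct
    edge saves a connecting vertex, which leaves one for each side. *)
Lemma link_four_singletons L p q :
  (forall y, Y y -> hits y p) -> (forall y, Y y -> hits y q) ->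
  (forall y y', Y y -> Y y' -> y != y' -> ~~ near y p -> ~~ near y' p -> red y y') ->
  segs L -> uniq [:: e1, e2, p.1, p.2, q.1, q.2 & flatten L] ->
  size L = 4 -> count (free p) L = 2 -> ~~ has nontriv L ->
  (forall C, C \in L -> free q C = ~~ free p C) ->
  has_path red (size (flatten L) + 4).
Proof.
move=> hp hq direct sL U sz_L p2 short qp.
have Up : uniq [:: e1; e2; p.1; p.2] by apply: uniq_sub_count U _; count_lia.
have Uq : uniq [:: e1; e2; q.1; q.2] by apply: uniq_sub_count U _; count_lia.
have single C : C \in L -> exists2 c, Y c & C = [:: c] /\ free p C = near c p.
  move=> CL; have [c [c' [RC Yc _]]] := sL C CL; exists c => //.
  have /= := hasPn short C CL; rewrite /free !(rpath_ends RC).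
  by case: C RC {CL} => [|x [|]] //= /andP[/eqP -> /eqP ->] _; rewrite orbb.
have := count_predC (free p) L; rewrite sz_L p2 -!size_filter => -[].
have : perm_eq L (filter (predC (free p)) L ++ filter (free p) L).
  by rewrite perm_sym perm_catC perm_filterC.
have memF := mem_filter (free p) ^~ L; have memG := mem_filter (predC (free p)) ^~ L.
move: p2 memF memG; rewrite -size_filter.
case: (filter (free p) L) => [|C3 [|C4 []]] // _ memF.
case: (filter (predC _) L) => [|C1 [|C2 []]] // memG PL _.
have far C : C \in [:: C1; C2] -> exists2 y, Y y &
    [/\ C = [:: y], ~~ near y p, near y q & red y e1 && red y e2].
  rewrite memG /= => /andP[nf CL]; have [y Yy [Cy fy]] := single C CL.
  exists y => //; split=> //; first by rewrite -fy.
    have := qp C CL; rewrite nf {1}Cy /free /= orbb => ->//.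
  by apply: far_ends Up Yy (hp _ Yy) _; rewrite -fy.
have close C : C \in [:: C3; C4] -> exists2 y, Y y &
    [/\ C = [:: y], near y p & red y e1 && red y e2].
  rewrite memF => /andP[nf CL]; have [y Yy [Cy fy]] := single C CL.
  exists y => //; split=> //; first by rewrite -fy.
  apply: far_ends Uq Yy (hq _ Yy) _.
  by have := qp C CL; rewrite nf {1}Cy /free /= orbb => ->.
have [y1 Y1 [E1 f1 n1 /andP[y1e _]]] := far C1 (mem_head _ _).
have [|y2 Y2 [E2 f2 _ /andP[y2e _]]] := far C2; first by rewrite !inE eqxx orbT.
have [y3 Y3 [E3 _ /andP[y3e y3e']]] := close C3 (mem_head _ _).
have [|y4 Y4 [E4 n4 /andP[_ y4e']]] := close C4; first by rewrite !inE eqxx orbT.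
have {memF memG far close} := perm_flatten PL; rewrite E1 E2 E3 E4 /= => PF.
have {}U : uniq [:: e1, e2, p.1, p.2, q.1, q.2 & [:: y1; y2; y3; y4]].
  by apply: uniq_sub_count U _ => x; rewrite /= (permP PF) /=; nat_lia.
have y12 : red y1 y2.
  apply: direct => //; apply: (@uniq_neq [:: y1] [:: y2]); rewrite ?mem_head //.
  by apply: uniq_sub_count U _; count_lia.
rewrite (perm_size PF) /=.
have [[a aq y1a] [b bp y4b]] := (near_hits n1, near_hits n4).
exists [:: a; y1; y2; e1; y3; e2; y4; b]; split=> //.
  by move: aq bp; rewrite !inE => /pred2P[]-> /pred2P[]->;
    apply: uniq_sub_count U _; count_lia.
by rewrite /= y12 y2e y3e' y4b (red_sym a) (red_sym e1) (red_sym e2) y1a y3e y4e'.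
Qed.

(** Each merge consumes one pair and adds one vertex, so the invariant is
    size L + b <= size Ps + 2 and the final number of vertices does not change.
    The flag b tells whether both sides of the final path are extended (odd n)
    or only one is (even n). *)
Lemma link_segments (b : bool) L Ps :
  (forall p y, p \in Ps -> Y y -> hits y p) ->
  (forall p y y', p \in Ps -> Y y -> Y y' -> y != y' ->
     ~~ near y p -> ~~ near y' p -> red y y') ->
  segs L ->
  uniq [:: e1, e2 & pair_vertices Ps ++ flatten L] ->
  2 < size L -> size L + b <= size Ps + 2 ->
  has_path red (size (flatten L) + size L + b).
Proof.
have [n] := ubnP (size L); elim: n b L Ps => // n IHn b L Ps le_n hPs dPs sL U.
have step L' Ps' p : merged p L L' -> perm_eq Ps (p :: Ps') -> 3 < size L ->
    size L + b <= size Ps + 2 -> has_path red (size (flatten L) + size L + b).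
  move=> [sL' sz_L' [w wp PL'] lL'] PPs lt3 szPs.
  have -> : size (flatten L) + size L = size (flatten L') + size L'.
    by rewrite (perm_size PL') sz_L' /= addSn addnS.
  have szPP := perm_size PPs.
  apply: (IHn b L' Ps') => //.
  - by move: le_n sz_L'; clear; lia.
  - by move=> r y rP; apply: hPs; rewrite (perm_mem PPs) inE rP orbT.
  - by move=> r y y' rP; apply: dPs; rewrite (perm_mem PPs) inE rP orbT.
  - have PV := perm_pair_vertices PPs.
    apply: uniq_sub_count U _ => x; rewrite /= !count_cat (permP PL') (permP PV) /=.
    by move: wp; rewrite !inE => /pred2P[]->; nat_lia.
  - by move: lt3 sz_L'; clear; lia.
  - by move: szPs szPP sz_L' => /=; clear; lia.
rewrite leq_eqVlt => /predU1P[/esym sz_L|lt3] szPs.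
  rewrite sz_L; case: Ps hPs {dPs} U szPs {step} => [|p Ps] hPs U.
    by rewrite sz_L; case: (b).
  have hp y : Y y -> hits y p by apply: hPs; rewrite mem_head.
  case: b Ps hPs U => [[|q Ps]|Ps] hPs U; rewrite sz_L // => _.
    rewrite -addnA; apply: (join_three_long hp _ sL sz_L (q := q)).
      by move=> y; apply: hPs; rewrite !inE eqxx orbT.
    by apply: uniq_sub_count U _; rewrite /pair_vertices; count_lia.
  rewrite addn0; apply: (join_three hp sL sz_L).
  by apply: uniq_sub_count U _; rewrite /pair_vertices; count_lia.
case: Ps hPs dPs U step szPs => [|p [|q Ps]] hPs dPs U step szPs.
- by move: szPs lt3 => /=; clear; lia.
- by move: szPs lt3 => /=; clear; lia.
have hp y : Y y -> hits y p by apply: hPs; rewrite mem_head.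
have hq y : Y y -> hits y q by apply: hPs; rewrite !inE eqxx orbT.
have [|[L' M]|[L' M]|[sz_L p2 nlong qp]] := merge_one hp hq sL _ lt3.
- by apply: uniq_sub_count U _; rewrite /pair_vertices; count_lia.
- exact: step M (perm_refl _) lt3 szPs.
- by apply: (step _ (p :: Ps) _ M _ lt3 szPs); rewrite (perm_catCA [:: p] [:: q]).
case: b step szPs => step szPs; last first.
  rewrite sz_L addn0; apply: (link_four_singletons hp hq _ sL _ sz_L p2 nlong qp).
    by move=> y y'; apply: dPs; rewrite mem_head.
  by apply: uniq_sub_count U _; rewrite /pair_vertices; count_lia.
(* Every segment misses p or q, so none of them misses a third pair r. *)
rewrite sz_L in szPs; case: Ps hPs U dPs step szPs => [|r Ps] // hPs U _ step szPs.
have hr y : Y y -> hits y r by apply: hPs; rewrite !inE eqxx !orbT.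
have [|L' M] := @merge_three r L sL.
  suff -> : count (free r) L = size L by rewrite sz_L.
  apply/eqP; rewrite -all_count; apply/allP => C CL.
  have [c [c' SC]] := sL C CL; have [RC Yc _] := SC.
  have Upr : uniq [:: p.1; p.2; r.1; r.2].
    by apply: uniq_sub_count U _; rewrite /pair_vertices; count_lia.
  have Uqr : uniq [:: q.1; q.2; r.1; r.2].
    by apply: uniq_sub_count U _; rewrite /pair_vertices; count_lia.
  rewrite /free (rpath_ends RC); apply/orP; left.
  have [fp|/(not_free SC)[cF _]] := boolP (free p C); last first.
    exact: far_near Upr (hp _ Yc) (hr _ Yc) cF.
  have : ~~ free q C by rewrite (qp C CL) fp.
  by case/(not_free SC) => cF _; apply: far_near Uqr (hq _ Yc) (hr _ Yc) cF.
apply: (step _ [:: p, q & Ps] _ M) => //; last by rewrite sz_L.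
by rewrite (perm_catCA [:: p; q] [:: r]).
Qed.

End Linking.

(** * Around a blue path that cannot be made longer *)

Fixpoint pairs_of (T : Type) (s : seq T) : seq (T * T) :=
  if s is u :: v :: s' then (u, v) :: pairs_of s' else [::].

Lemma size_pairs_of T (s : seq T) : size (pairs_of s) = (size s)./2.
Proof. by move: s; fix IH 1; case=> [|u [|v s]] //=; rewrite IH. Qed.

Lemma pairs_ofP (T : eqType) (s : seq T) p : p \in pairs_of s ->
  exists s1 s2, s = s1 ++ [:: p.1, p.2 & s2].
Proof.
move: s; fix IH 1; case=> [|u [|v s]] //=; rewrite inE => /predU1P[->|ps].
  by exists [::], s.
by have [s1 [s2 ->]] := IH s ps; exists [:: u, v & s1], s2.
Qed.

Lemma count_pairs_of (T : eqType) (s : seq T) (a : pred T) :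
  count a (pair_vertices (pairs_of s)) <= count a s.
Proof.
move: s; fix IH 1; case=> [|u [|v s]] //=.
by have := IH s; rewrite /pair_vertices; nat_lia.
Qed.

Record matching_coloring (T : eqType) (red blue green : rel T) : Prop := {
  red_sym : symmetric red;
  blue_sym : symmetric blue;
  green_sym : symmetric green;
  colored : forall x y, x != y -> [|| red x y, blue x y | green x y];
  green_match : forall x y z, green x y -> green x z -> y = z
}.

Section Outside.
Variables (T : eqType) (red blue green : rel T).
Hypothesis col : matching_coloring red blue green.
Variables (e1 e2 : T) (mid : seq T).
Notation X := (e1 :: mid ++ [:: e2]).
Hypothesis UX : uniq X.
Hypothesis RX : rpath blue e1 e2 X.
Hypothesis noblue : ~ has_path blue (size X).+1.
Let Y := [pred y | y \notin X].

Let blueC := blue_sym col.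
Let redC := red_sym col.
Let greenC := green_sym col.
Let gmatch := green_match col.

Lemma rpath_split (e : rel T) a z u v s1 s2 : rpath e a z (s1 ++ [:: u, v & s2]) ->
  rpath e a u (s1 ++ [:: u]) /\ rpath e v z (v :: s2).
Proof.
case: s1 => [|x s1] /=.
  by case/andP=> /eqP -> /andP[/andP[_ ->]] /eqP ->; rewrite !eqxx.
case/and3P=> ->; rewrite !cat_path !last_cat /= => /and4P[-> -> _ ->] /eqP ->.
by rewrite !eqxx.
Qed.

Lemma not_blue_head y : Y y -> ~~ blue y e1.
Proof.
move=> Yy; apply/negP => ye; apply: noblue.
have U : uniq (y :: X) by rewrite cons_uniq UX andbT.
by join_path (rpath_cat (rpath1 blue y) ye RX) U.
Qed.

Lemma not_blue_last y : Y y -> ~~ blue y e2.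
Proof.
move=> Yy; apply/negP => ye; apply: noblue.
have U : uniq (y :: X) by rewrite cons_uniq UX andbT.
by join_path (rpath_cat RX (etrans (blueC _ _) ye) (rpath1 blue y)) U.
Qed.

Lemma not_blue_pair y u v s1 s2 : X = s1 ++ [:: u, v & s2] -> Y y ->
  ~~ (blue y u && blue y v).
Proof.
move=> EX Yy; apply/negP => /andP[yu yv]; apply: noblue.
have U : uniq (y :: X) by rewrite cons_uniq UX andbT.
have RX' := RX; rewrite EX in RX' U *; have [R1 R2] := rpath_split RX'.
by join_path (rpath_cat (rpath_cat R1 (etrans (blueC _ _) yu) (rpath1 blue y)) yv R2) U.
Qed.

Lemma not_blue_cross y y' u v s1 s2 : X = s1 ++ [:: u, v & s2] -> Y y -> Y y' ->
  y != y' -> blue y u -> blue y' v -> ~~ blue y y'.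
Proof.
move=> EX Yy Yy' yy' yu y'v; apply/negP => byy'; apply: noblue.
have U : uniq [:: y, y' & X].
  by rewrite 2!cons_uniq UX andbT inE negb_or yy' /= [_ \notin _]Yy [_ \notin _]Yy'.
have RX' := RX; rewrite EX in RX' U *; have [R1 R2] := rpath_split RX'.
apply: (@has_pathW _ _ (size (s1 ++ [:: u, v & s2])).+2) => //.
by join_path (rpath_cat (rpath_cat (rpath_cat R1 (etrans (blueC _ _) yu)
  (rpath1 blue y)) byy' (rpath1 blue y')) y'v R2) U.
Qed.

(** Otherwise y - u - e1 - v - s would be longer. *)
Lemma not_blue_skip y u v s : X = [:: e1, u, v & s] -> Y y -> blue y u -> ~~ blue e1 v.
Proof.
move=> EX Yy yu; apply/negP => ev; apply: noblue.
have U : uniq (y :: X) by rewrite cons_uniq UX andbT.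
have RX' := RX; rewrite EX in RX' U *.
have [R1 R2] := @rpath_split _ _ _ _ _ [:: e1] _ RX'.
have R := rpath_cat (rpath_cat (rpath1 blue y) yu (rpath_rev blueC R1)) ev R2.
by join_path R U.
Qed.

(** Otherwise y' - y - u - s would be longer: e1 is dropped and two vertices are
    added. *)
Lemma not_blue_tail y y' u s : X = [:: e1, u & s] -> Y y -> Y y' -> y != y' ->
  blue y u -> ~~ blue y y'.
Proof.
move=> EX Yy Yy' yy' yu; apply/negP => byy'; apply: noblue.
have U : uniq [:: y, y' & X].
  by rewrite 2!cons_uniq UX andbT inE negb_or yy' /= [_ \notin _]Yy [_ \notin _]Yy'.
have RX' := RX; rewrite EX in RX' U *.
have [_ R2] := @rpath_split _ _ _ _ _ [::] _ RX'.
have R := rpath_cat (rpath_cat (rpath1 blue y') (etrans (blueC _ _) byy')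
  (rpath1 blue y)) yu R2.
by join_path R U.
Qed.

Lemma red_or_green x y : x != y -> ~~ blue x y -> red x y || green x y.
Proof. by move=> /(colored col) /or3P[->|->|->]; rewrite ?orbT. Qed.

Lemma out_neq y x : Y y -> x \in X -> y != x.
Proof. by move=> Yy xX; apply: contraNneq Yy => ->. Qed.

Lemma Y_e1 y : Y y -> red y e1 || green y e1.
Proof.
move=> Yy; apply: red_or_green (not_blue_head Yy); apply: out_neq Yy _.
exact: mem_head.
Qed.

Lemma Y_e2 y : Y y -> red y e2 || green y e2.
Proof.
move=> Yy; apply: red_or_green (not_blue_last Yy); apply: out_neq Yy _.
by rewrite inE mem_cat mem_head !orbT.
Qed.

Lemma mid_pair p : p \in pairs_of mid ->
  exists s1 s2, X = s1 ++ [:: p.1, p.2 & s2].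
Proof.
by case/pairs_ofP=> s1 [s2 ->]; exists (e1 :: s1), (s2 ++ [:: e2]); rewrite /= -catA.
Qed.

Lemma pair_mem u v s1 s2 : X = s1 ++ [:: u, v & s2] -> [/\ u \in X, v \in X & u != v].
Proof.
move=> EX; rewrite EX !mem_cat !inE !eqxx !orbT; split=> //.
by move: UX; rewrite EX cat_uniq => /and3P[_ _]; rewrite /= inE negb_or => /andP[/andP[]].
Qed.

Lemma hits_pair p y : p \in pairs_of mid -> Y y -> hits red green y p.
Proof.
case/mid_pair=> s1 [s2 EX] Yy; have [uX vX _] := pair_mem EX.
have := not_blue_pair EX Yy; rewrite negb_and /hits /near => /orP[nb|nb].
  by have := red_or_green (out_neq Yy uX) nb; case/orP=> ->; rewrite ?orbT.
by have := red_or_green (out_neq Yy vX) nb; case/orP=> ->; rewrite ?orbT.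
Qed.

Lemma far_pair u v s1 s2 y : X = s1 ++ [:: u, v & s2] -> Y y -> ~~ red y u -> ~~ red y v ->
  (green y u /\ blue y v) \/ (blue y u /\ green y v).
Proof.
move=> EX Yy nu nv; have [uX vX uv] := pair_mem EX.
have := colored col (out_neq Yy uX); have := colored col (out_neq Yy vX).
rewrite (negPf nu) (negPf nv) /=.
case/orP=> yv /orP[] yu; [|by left|by right|].
  by have := not_blue_pair EX Yy; rewrite yu yv.
by case/eqP: uv; apply: gmatch yu yv.
Qed.

(** One of y and y' is blue to u and the other one to v, so a blue edge y y' would
    fit between u and v; and the green edges at y and y' are used up. *)
Lemma direct_pair u v s1 s2 y y' : X = s1 ++ [:: u, v & s2] -> Y y -> Y y' -> y != y' ->
  ~~ red y u -> ~~ red y v -> ~~ red y' u -> ~~ red y' v ->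
  red y y' /\ (green y u /\ green y' v /\ blue y' u \/ green y v /\ green y' u /\ blue y u).
Proof.
move=> EX Yy Yy' yy' yu yv y'u y'v; have [uX vX uv] := pair_mem EX.
have ngreen w : w \in X -> green y w -> ~~ green y y'.
  move=> wX gw; apply/negP => gy; have := out_neq Yy' wX.
  by rewrite (gmatch gy gw) eqxx.
have isred w : w \in X -> green y w -> ~~ blue y y' -> red y y'.
  by move=> wX gw /(red_or_green yy'); rewrite (negPf (ngreen w wX gw)) orbF.
have same w : green y w -> green y' w -> False.
  by rewrite greenC (greenC y') => a b; case/eqP: yy'; apply: gmatch a b.
case: (far_pair EX Yy yu yv) (far_pair EX Yy' y'u y'v) => -[a b] [] [a' b'].
- by case: (same u).
- split; last by left.
  by apply: isred uX a _; rewrite blueC; apply: not_blue_cross EX _ _ _ a' b; rewrite // eq_sym.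
- split; last by right.
  by apply: isred vX b _; apply: not_blue_cross EX _ _ _ a b'.
- by case: (same v).
Qed.

Let e12 : e1 != e2.
Proof. by move: UX; rewrite /= mem_cat !inE negb_or => /andP[/andP[]]. Qed.

(** The number of pairs suffices: the interior has at least
    2 (size ys) + b - 3 vertices, hence at least size ys + b - 2 pairs. *)
Lemma red_path_many_outside (b : bool) ys : uniq ys -> all Y ys -> 2 < size ys ->
  (size ys).*2 + b <= (size X).+1 -> has_path red ((size ys).*2 + b).
Proof.
move=> Uys Yys ys3 szX; set L := [seq [:: y] | y <- ys].
have FL : flatten L = ys by rewrite /L; elim: (ys) => //= y s ->.
have -> : (size ys).*2 + b = size (flatten L) + size L + b.
  by rewrite FL size_map addnn.
have Pmid p : p \in pairs_of mid -> exists s1 s2, X = s1 ++ [:: p.1, p.2 & s2].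
  exact: mid_pair.
apply: (link_segments redC greenC gmatch Y_e1 Y_e2 e12 (Ps := pairs_of mid)).
- by move=> p y pm; apply: hits_pair.
- move=> p y y' /Pmid[s1 [s2 EX]] Yy Yy' yy' /norP[a b'] /norP[c d].
  by case: (direct_pair EX Yy Yy' yy' a b' c d).
- move=> C /mapP[y /(allP Yys) Yy ->]; exists y, y; split=> //; exact: rpath1.
- have U : uniq (X ++ ys).
    rewrite cat_uniq UX Uys andbT; apply/hasPn => y /(allP Yys); exact.
  rewrite FL; apply: uniq_sub_count U _ => x; rewrite /= !count_cat /=.
  by have := count_pairs_of mid (pred1 x); nat_lia.
- by rewrite size_map.
- rewrite size_map size_pairs_of; move: szX; rewrite /= size_cat /= addn1.
  by move: (size mid) (size ys) => k l; clear; case: b; lia.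
Qed.

(** In the second case the green edges at y1 and y2 both go to the ends of the
    path, so all other edges at y1 and y2 are red or blue. *)
Lemma joined_or_crossed y1 y2 : Y y1 -> Y y2 ->
  (exists f f', [/\ perm_eq [:: f; f'] [:: e1; e2], red y1 f & red y2 f]) \/
  (exists f f', [/\ perm_eq [:: f; f'] [:: e1; e2],
     red y1 f /\ green y1 f' & red y2 f' /\ green y2 f]).
Proof.
move=> Y1 Y2.
have [f [f' [Pf y1f]]] := some_end gmatch Y_e1 Y_e2 e12 Y1.
have /andP[_ y1f'] := Y_end Y_e1 Y_e2 Pf Y1.
have /andP[y2f y2f'] := Y_end Y_e1 Y_e2 Pf Y2.
have ff' : f != f'.
  have : uniq [:: f; f'] by rewrite (perm_uniq Pf) /= inE e12.
  by rewrite /= inE andbT.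
case/orP: y2f => [y2f|gy2f]; first by left; exists f, f'.
case/orP: y2f' => [y2f'|gy2f']; last by case/eqP: ff'; apply: gmatch gy2f gy2f'.
case/orP: y1f' => [y1f'|gy1f']; last by right; exists f, f'.
by left; exists f', f; rewrite (perm_catC [:: f'] [:: f]).
Qed.

Lemma crossed_not_green y y' f : Y y' -> f \in [:: e1; e2] -> green y f ->
  ~~ green y y'.
Proof.
move=> Yy' fe gf; apply/negP => gy.
have fX : f \in X by move: fe; rewrite !inE mem_cat inE => /orP[]->; rewrite ?orbT.
by have := out_neq Yy' fX; rewrite (gmatch gy gf) eqxx.
Qed.

(** If no end of the blue path is red to both vertices, their green edges go to
    these ends.  Then the neighbour u of e1 on the path either joins y1 and y2,
    or is blue to one of them, and then y1 y2 is red by not_blue_tail. *)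
Lemma red_path_two_outside y1 y2 : Y y1 -> Y y2 -> y1 != y2 -> 0 < size mid -> has_path red 4.
Proof.
move=> Y1 Y2 y12.
have U : uniq [:: y1, y2 & X].
  by rewrite 2!cons_uniq UX andbT inE negb_or y12 /= [_ \notin _]Y1 [_ \notin _]Y2.
have Uf f f' : perm_eq [:: f; f'] [:: e1; e2] -> uniq [:: f, f', y1, y2 & mid].
  move=> Pf; rewrite (perm_uniq (perm_cat Pf (perm_refl [:: y1, y2 & mid]))).
  by apply: uniq_sub_count U _; count_lia.
have [[f [f' [Pf y1f y2f]]]|[f [f' [Pf [y1f g1] [y2f' g2]]]]] := joined_or_crossed Y1 Y2.
  move=> _; have {}U := Uf _ _ Pf.
  have [/orP[y1f'|g1] /orP[y2f'|g2]] :=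
    (proj2 (andP (Y_end Y_e1 Y_e2 Pf Y1)), proj2 (andP (Y_end Y_e1 Y_e2 Pf Y2))).
  4: by case/eqP: y12; move: g1 g2; rewrite ![green _ f']greenC; apply: gmatch.
  1-2: exists [:: f'; y1; f; y2]; split=> //; first by apply: uniq_sub_count U _; count_lia.
  1-2: by rewrite /= redC y1f' y1f redC y2f.
  exists [:: y1; f; y2; f']; split=> //; first by apply: uniq_sub_count U _; count_lia.
  by rewrite /= y1f redC y2f y2f'.
have {}U := Uf _ _ Pf; have memf := perm_mem Pf.
have ngreen : ~~ green y1 y2.
  by apply: crossed_not_green Y2 _ g1; rewrite -memf !inE eqxx orbT.
have direct : ~~ blue y1 y2 -> has_path red 4.
  move=> /(red_or_green y12); rewrite (negPf ngreen) orbF => r12.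
  exists [:: f; y1; y2; f']; split=> //; first by apply: uniq_sub_count U _; count_lia.
  by rewrite /= redC y1f r12 y2f'.
case E: mid => [|u s] // _; have EX : X = [:: e1, u & s ++ [:: e2]] by rewrite E.
have [b1|b1] := boolP (blue y1 u); first exact: direct (not_blue_tail EX Y1 Y2 y12 b1).
have [b2|b2] := boolP (blue y2 u).
  by apply: direct; rewrite blueC; apply: not_blue_tail EX Y2 Y1 _ b2; rewrite eq_sym.
have uX : u \in X by rewrite EX !inE eqxx orbT.
have fu : (f != u) && (f' != u).
  by move: U; rewrite E /= !inE !negb_or => /and3P[/and5P[_ _ _ -> _] /and4P[_ _ -> _] _].
case/andP: fu => fu f'u.
have := red_or_green (out_neq Y1 uX) b1; have := red_or_green (out_neq Y2 uX) b2.
case/orP=> [y2u|g]; last by case/eqP: fu; apply: gmatch g2 g.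
case/orP=> [y1u|g]; last by case/eqP: f'u; apply: gmatch g1 g.
exists [:: f; y1; u; y2]; split=> //.
  by rewrite E in U; apply: uniq_sub_count U _; count_lia.
by rewrite /= redC y1f y1u redC y2u.
Qed.

(** The critical pair is u, v, next to e1 on the path.  A vertex y outside that is
    blue to u makes e1 v not blue, by not_blue_skip; this supplies a red edge e1 v
    in the two cases where the pair does not link y1 and y2: when both miss the
    pair, and when each sees a different vertex of it and no end of the path is
    red to both. *)
Lemma red_path_two_outside_long y1 y2 : Y y1 -> Y y2 -> y1 != y2 -> 1 < size mid -> has_path red 5.
Proof.
move=> Y1 Y2 y12.
have U0 : uniq [:: y1, y2 & X].
  by rewrite 2!cons_uniq UX andbT inE negb_or y12 /= [_ \notin _]Y1 [_ \notin _]Y2.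
case E: mid => [|u [|v s]] // _.
have EX0 : X = [:: e1, u, v & s ++ [:: e2]] by rewrite E.
have EX : X = [:: e1] ++ [:: u, v & s ++ [:: e2]] by [].
pose p := (u, v).
have U : uniq [:: e1, e2, p.1, p.2 & [:: y1] ++ [:: y2]].
  by rewrite E in U0; apply: uniq_sub_count U0 _; count_lia.
have hp y : Y y -> hits red green y p.
  by apply: hits_pair; rewrite E mem_head.
have Up : uniq [:: e1; e2; p.1; p.2] by apply: uniq_sub_count U _; count_lia.
have [uX vX uv] := pair_mem EX.
have e1v : e1 != v.
  by move: Up; rewrite /= !inE !negb_or => /and3P[/and3P[_ _ ->]].
have e1Y y : Y y -> e1 != y by move=> Yy; rewrite eq_sym (out_neq Yy) ?mem_head.
have far_e y : Y y -> ~~ near red y p -> red y e1 && red y e2.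
  by move=> Yy; apply: (far_ends gmatch Y_e1 Y_e2 Up Yy (hp y Yy)).
have R1 := rpath1 red y1; have R2 := rpath1 red y2.
have swapU : uniq [:: e1, e2, p.1, p.2 & [:: y2] ++ [:: y1]].
  by apply: uniq_sub_count U _; count_lia.
have [n1|f1] := boolP (near red y1 p); have [n2|f2] := boolP (near red y2 p).
- have share w : w \in [:: u; v] -> red y1 w -> red y2 w -> has_path red 5.
    move=> wp y1w y2w.
    apply: (link_shared redC greenC gmatch Y_e1 Y_e2 e12 R1 R2 Y1 Y2 y1w y2w).
    by move: wp; rewrite !inE => /pred2P[]->; apply: uniq_sub_count U _; count_lia.
  have crossed y y' : Y y -> Y y' -> y != y' ->
      uniq [:: e1, e2, p.1, p.2 & [:: y] ++ [:: y']] ->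
      red y u -> ~~ red y v -> ~~ red y' u -> red y' v -> has_path red 5.
    move=> Yy Yy' yy' Uy yu nyv ny'u y'v.
    have [[f [f' [Pf yf y'f]]]|[f [f' [Pf [yf g] [y'f' g']]]]] := joined_or_crossed Yy Yy'.
      apply: (link_crossed redC (rpath1 red y) (rpath1 red y') yu y'v yf y'f).
      have Uf : uniq [:: f, f', p.1, p.2 & [:: y] ++ [:: y']] by apply: perm_ends Pf Uy.
      by apply: uniq_sub_count Uf _; count_lia.
    have Uf : uniq [:: f, f', p.1, p.2 & [:: y] ++ [:: y']] by apply: perm_ends Pf Uy.
    have [fu f'v] : f != u /\ f' != v.
      by move: Uf; rewrite /= !inE !negb_or => /andP[/and5P[_ -> _ _ _] /andP[/and4P[_ -> _ _] _]].
    have byv : blue y v.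
      have := colored col (out_neq Yy vX); rewrite (negPf nyv) /= => /orP[//|gv].
      by case/eqP: f'v; apply: gmatch g gv.
    have by'u : blue y' u.
      have := colored col (out_neq Yy' uX); rewrite (negPf ny'u) /= => /orP[//|gu].
      by case/eqP: fu; apply: gmatch g' gu.
    have memf := perm_mem Pf.
    have ryy' : red y y'.
      have ng : ~~ green y y'.
        by apply: crossed_not_green Yy' _ g; rewrite -memf !inE eqxx orbT.
      have := red_or_green yy' _; rewrite (negPf ng) orbF; apply.
      by rewrite blueC; apply: not_blue_cross EX Yy' Yy _ by'u byv; rewrite eq_sym.
    have e1v_red : red e1 v.
      have := red_or_green e1v (not_blue_skip EX0 Yy' by'u).
      case/orP=> // gv; have : e1 \in [:: f; f'] by rewrite memf mem_head.
      rewrite !inE => /pred2P[] ee; move: gv; rewrite ee => gv.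
        by have := out_neq Yy' vX; rewrite (gmatch (etrans (greenC _ _) g') gv) eqxx.
      by have := out_neq Yy vX; rewrite (gmatch (etrans (greenC _ _) g) gv) eqxx.
    have : e1 \in [:: f; f'] by rewrite memf mem_head.
    rewrite !inE => /pred2P[] ee; rewrite ee in e1v_red.
      exists [:: f'; y'; y; f; v]; split=> //; first by apply: uniq_sub_count Uf _; count_lia.
      by rewrite /= redC y'f' redC ryy' yf e1v_red.
    exists [:: f; y; y'; f'; v]; split=> //; first by apply: uniq_sub_count Uf _; count_lia.
    by rewrite /= redC yf ryy' y'f' e1v_red.
  have up : u \in [:: u; v] by rewrite mem_head.
  have vp : v \in [:: u; v] by rewrite !inE eqxx orbT.
  have [y1u|ny1u] := boolP (red y1 u); have [y2u|ny2u] := boolP (red y2 u).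
  + exact: share up y1u y2u.
  + move: n2; rewrite /near (negPf ny2u) /= => y2v.
    have [y1v|ny1v] := boolP (red y1 v); first exact: share vp y1v y2v.
    exact: crossed Y1 Y2 y12 U y1u ny1v ny2u y2v.
  + move: n1; rewrite /near (negPf ny1u) /= => y1v.
    have [y2v|ny2v] := boolP (red y2 v); first exact: share vp y1v y2v.
    by apply: crossed Y2 Y1 _ swapU y2u ny2v ny1u y1v; rewrite eq_sym.
  + move: n1 n2; rewrite /near (negPf ny1u) (negPf ny2u) /=; exact: share.
- exact: (link_far redC greenC gmatch Y_e1 Y_e2 e12 R2 R1 Y2 Y1 (far_e _ Y2 f2) n1 swapU).
- exact: (link_far redC greenC gmatch Y_e1 Y_e2 e12 R1 R2 Y1 Y2 (far_e _ Y1 f1) n2 U).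
have [/andP[y1e1 y1e2] /andP[y2e1 y2e2]] := (far_e _ Y1 f1, far_e _ Y2 f2).
have rev1 : red e1 v.
  have reddish y y' : Y y -> Y y' -> green y v -> blue y' u -> red e1 v.
    move=> Yy Yy' gv bu; have := red_or_green e1v (not_blue_skip EX0 Yy' bu).
    case/orP=> // ge; have /eqP[] := e1Y y Yy.
    by rewrite greenC in ge; rewrite greenC in gv; apply: gmatch ge gv.
  move: f1 f2; rewrite /near => /norP[a b] /norP[c d].
  have [_ [[_ [g bu]]|[g [_ bu]]]] := direct_pair EX Y1 Y2 y12 a b c d.
    exact: (reddish _ _ Y2 Y2 g bu).
  exact: (reddish _ _ Y1 Y1 g bu).
exists [:: v; e1; y1; e2; y2]; split=> //; first by apply: uniq_sub_count U _; count_lia.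
by rewrite /= redC rev1 redC y1e1 y1e2 redC y2e2.
Qed.

End Outside.

Lemma has_pathP (T : finType) (e : rel T) k :
  reflect (has_path e k) [exists t : k.-tuple T, uniq t && sorted e t].
Proof.
apply: (iffP existsP) => [[t /andP[Ut et]]|[s [Us /eqP sz_s es]]].
  by exists t; rewrite size_tuple.
by exists (Tuple sz_s); rewrite Us.
Qed.

(** * The upper bound *)

Lemma unique_neighbor (T : eqType) (e : rel T) x y z : symmetric e -> ~ has_path e 3 ->
  x != y -> x != z -> e x y -> e x z -> y = z.
Proof.
move=> eC no3 xy xz exy exz; apply/eqP/negPn/negP => yz; apply: no3.
by exists [:: y; x; z]; rewrite /= !inE exz eC exy negb_or eq_sym xy yz xz.
Qed.

Section Upper.
Variables (T : finType).
Implicit Types (red blue green : rel T).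

Lemma red_path_outside red blue green n m : matching_coloring red blue green ->
  4 <= n <= m -> m + n./2 - 1 <= #|T| ->
  has_path blue m.-1 -> ~ has_path blue m -> has_path red n.
Proof.
move=> col /andP[n4 nm] szT [s [Us sz_s bs]] nob.
have m4 := leq_trans n4 nm.
case: s => [|e1 s] in Us sz_s bs *; first by move: sz_s m4 => /=; lia.
case/lastP: s => [|mid e2] in Us sz_s bs *; first by move: sz_s m4 => /=; lia.
rewrite -cats1 in Us sz_s bs.
have sz_mid : size mid = m - 3 by move: sz_s; rewrite /= size_cat /=; lia.
have RX : rpath blue e1 e2 (e1 :: mid ++ [:: e2]).
  by rewrite /= eqxx [path _ _ _]bs last_cat eqxx.
have nob' : ~ has_path blue (size (e1 :: mid ++ [:: e2])).+1.
  by rewrite sz_s prednK //; lia.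
pose ys := take n./2 (enum [predC e1 :: mid ++ [:: e2]]).
have sz_ys : size ys = n./2.
  rewrite size_takel // -cardE.
  have := cardC (mem (e1 :: mid ++ [:: e2])); rewrite (card_uniqP Us) sz_s.
  by move: szT; set a := #|_|; set b := #|_| => szT; lia.
have Uys : uniq ys by rewrite take_uniq // enum_uniq.
have out : all [pred y | y \notin e1 :: mid ++ [:: e2]] ys.
  by apply/allP => y /mem_take; rewrite mem_enum.
have [two|many] := leqP n./2 2; last first.
  rewrite -(odd_double_half n) addnC -sz_ys.
  apply: (red_path_many_outside col Us RX nob' Uys out); first by rewrite sz_ys.
  by rewrite sz_ys addnC odd_double_half sz_s; lia.
have n2 : n./2 = 2 by lia.
rewrite n2 in sz_ys; case: ys sz_ys Uys out => [|y1 [|y2 []]] //= _.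
rewrite andbT inE => y12 /and3P[Y1 Y2 _].
have [n_4|n_5] : n = 4 \/ n = 5 by lia.
  by rewrite n_4; apply: (red_path_two_outside col Us RX nob' Y1 Y2 y12); lia.
by rewrite n_5; apply: (red_path_two_outside_long col Us RX nob' Y1 Y2 y12); lia.
Qed.

(** Red and green are both matchings here. *)
Lemma blue_among_three red blue green x a b c : matching_coloring red blue green ->
  ~ has_path red 3 -> uniq [:: x; a; b; c] -> [|| blue x a, blue x b | blue x c].
Proof.
move=> col nored; rewrite /= !inE !negb_or.
case/and4P=> /and3P[xa xb xc] /andP[ab ac] bc _.
have R := unique_neighbor (red_sym col) nored; have G := green_match col.
case/or3P: (colored col xa) (colored col xb) (colored col xc) => [ra|->//|ga].
all: case/or3P=> [rb|->|gb]; rewrite ?orbT //.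
all: case/or3P=> [rc|->|gc]; rewrite ?orbT //.
all: first [ case/eqP: ab; by [apply: (R x) | apply: (G x)]
           | case/eqP: ac; by [apply: (R x) | apply: (G x)]
           | case/eqP: bc; by [apply: (R x) | apply: (G x)]].
Qed.

(** Two blue edges x a, x b extend to a P_4 unless a third vertex c is joined to x
    only; then a fourth vertex d is blue to a leaf of this star. *)
Lemma blue_path4 red blue green : matching_coloring red blue green ->
  4 < #|T| -> ~ has_path red 3 -> has_path blue 4.
Proof.
move=> col T5 nored; have bC := blue_sym col.
have star x a b c d : uniq [:: x; a; b; c; d] -> blue x a -> blue x b ->
    has_path blue 4.
  move=> U xa xb.
  have /or3P[] : [|| blue c x, blue c a | blue c b].
    by apply: (blue_among_three col nored); apply: uniq_sub_count U _; count_lia.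
  - rewrite bC => xc.
    have /or3P[] : [|| blue d a, blue d b | blue d c].
      by apply: (blue_among_three col nored); apply: uniq_sub_count U _; count_lia.
    + move=> da; exists [:: d; a; x; b]; split=> //.
        by apply: uniq_sub_count U _; count_lia.
      by rewrite /= da bC xa xb.
    + move=> db; exists [:: d; b; x; a]; split=> //.
        by apply: uniq_sub_count U _; count_lia.
      by rewrite /= db bC xb xa.
    + move=> dc; exists [:: d; c; x; a]; split=> //.
        by apply: uniq_sub_count U _; count_lia.
      by rewrite /= dc bC xc xa.
  - move=> ca; exists [:: c; a; x; b]; split=> //.
      by apply: uniq_sub_count U _; count_lia.
    by rewrite /= ca bC xa xb.
  - move=> cb; exists [:: c; b; x; a]; split=> //.
      by apply: uniq_sub_count U _; count_lia.
    by rewrite /= cb bC xb xa.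
have : uniq (take 5 (enum T)) by rewrite take_uniq ?enum_uniq.
have : size (take 5 (enum T)) = 5 by rewrite size_takel // -cardE.
case: (take _ _) => [|x [|a [|b [|c [|d []]]]]] // _ U.
have go a' b' c' d' : perm_eq [:: a'; b'; c'; d'] [:: a; b; c; d] -> blue x a' ->
    has_path blue 4.
  move=> P xa; have {}U : uniq [:: x; a'; b'; c'; d'].
    by move: U; rewrite !(cons_uniq x) (perm_uniq P) (perm_mem P).
  have /or3P[] : [|| blue x b', blue x c' | blue x d'].
    by apply: (blue_among_three col nored); apply: uniq_sub_count U _; count_lia.
  - by move=> xb; apply: star U xa xb.
  - by move=> xc; apply: (star x a' c' b' d') => //; apply: uniq_sub_count U _; count_lia.
  - by move=> xd; apply: (star x a' d' b' c') => //; apply: uniq_sub_count U _; count_lia.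
have /or3P[] : [|| blue x a, blue x b | blue x c].
  by apply: (blue_among_three col nored); apply: uniq_sub_count U _; count_lia.
- by apply: go.
- by apply: (go b a c d); apply/permP => q /=; nat_lia.
- by apply: (go c a b d); apply/permP => q /=; nat_lia.
Qed.

(** A vertex y outside a longest blue path is not blue to its two ends, hence blue
    to every other vertex, in particular to two consecutive ones.  Blue P_4 is
    the start: a shorter path has no two consecutive interior vertices. *)
Lemma blue_path_matchings red blue green m : matching_coloring red blue green ->
  4 < #|T| -> m <= #|T| -> ~ has_path red 3 -> has_path blue m.
Proof.
move=> col T5 + nored; elim: m => [|m IHm] mT; first by exists [::].
have [m4|m4] := leqP m.+1 4.
  exact: has_pathW m4 (blue_path4 col T5 nored).
have [//|nob] := has_pathP blue m.+1.
have [s [Us sz_s bs]] := IHm (ltnW mT).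
case: s => [|e1 [|u [|v s]]] in Us sz_s bs *; try by move: sz_s m4 => /=; lia.
case/lastP: s => [|s e2] in Us sz_s bs *; first by move: sz_s m4 => /=; lia.
rewrite -cats1 in Us sz_s bs; pose mid := [:: u, v & s].
have UX : uniq (e1 :: mid ++ [:: e2]) by [].
have RX : rpath blue e1 e2 (e1 :: mid ++ [:: e2]).
  by rewrite /rpath eqxx [path _ _ _]bs last_cat eqxx.
have nob' : ~ has_path blue (size (e1 :: mid ++ [:: e2])).+1.
  by rewrite [size _]sz_s.
have /card_gt0P[y Yy] : 0 < #|[predC e1 :: mid ++ [:: e2]]|.
  have := cardC (mem (e1 :: mid ++ [:: e2])); rewrite (card_uniqP Us) [size _]sz_s.
  by move: mT; set a := #|_|; set b := #|_| => mT; lia.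
have U : uniq (y :: e1 :: mid ++ [:: e2]) by rewrite cons_uniq [_ \notin _]Yy.
exfalso.
have U2 w : w \in [:: u; v] -> uniq [:: y; e1; e2; w].
  by rewrite !inE => /pred2P[]->; apply: uniq_sub_count U _; count_lia.
have bw w : w \in [:: u; v] -> blue y w.
  move=> wp; have := blue_among_three col nored (U2 w wp).
  rewrite (negPf (not_blue_head UX RX nob' Yy)).
  by rewrite (negPf (not_blue_last col UX RX nob' Yy)).
have := @not_blue_pair _ _ _ _ col _ _ _ UX RX nob' y u v [:: e1] (s ++ [:: e2]) erefl Yy.
by rewrite !bw ?inE ?eqxx ?orbT.
Qed.

Theorem ramsey_path_upper red blue green n m : matching_coloring red blue green ->
  3 <= n <= m -> 4 < #|T| -> m + n./2 - 1 <= #|T| ->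
  has_path red n \/ has_path blue m.
Proof.
have [k] := ubnP (n + m); elim: k red blue n m => // k IHk red blue n m le_k col.
case/andP=> n3 nm T5 szT.
have [n_3|n4] : n = 3 \/ 3 < n by lia.
  have [|nored] := has_pathP red n; first by left.
  right; rewrite n_3 in nored szT.
  by apply: (blue_path_matchings col T5) nored; lia.
have [|nored] := has_pathP red n; first by left.
have [|noblue] := has_pathP blue m; first by right.
have [mn|n_m] : n < m \/ n = m by lia.
  have [//|b] : has_path red n \/ has_path blue m.-1.
    by apply: (IHk red blue n m.-1 _ col _ T5); lia.
  by left; apply: (red_path_outside col) szT b noblue; lia.
have col' : matching_coloring blue red green.
  case: col => ? ? ? tot ?; split=> // x y /tot; by rewrite orbCA.
have [r|] : has_path red n.-1 \/ has_path blue n.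
  by apply: (IHk red blue n.-1 n _ col _ T5); lia.
  by right; rewrite -n_m; apply: (red_path_outside col') r nored; lia.
by rewrite -n_m; right.
Qed.
End Upper.

(** * Path copies, arrows and lower bounds *)

Lemma has_copy_path (W : finType) (H : sgraph W) k :
  has_path H k -> has_copy (path_graph k) H.
Proof.
case=> s [Us sz_s Hs].
case: k sz_s => [|k] sz_s; first by exists (fun i : 'I_0 => False_rect W (notF (ltn_ord i))) => [[]|[]].
have [x0 _] : {x0 : W & true} by case: s sz_s {Us Hs} => // x s _; exists x.
exists (fun i : 'I_k.+1 => nth x0 s i).
  move=> i j /eqP; rewrite nth_uniq ?sz_s ?ltn_ord // => /eqP; exact: val_inj.
have step i j : i.+1 = j -> j < size s -> H (nth x0 s i) (nth x0 s j).
  by move=> <- ij; have /(sortedP x0) := Hs; apply.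
move=> i j /orP[] /eqP ij; first by apply: step; rewrite ?sz_s.
by rewrite adj_sym; apply: step; rewrite ?sz_s.
Qed.

Lemma has_copy_path3 (W : finType) (H : sgraph W) k : 2 < k ->
  has_copy (path_graph k) H ->
  exists x y z, [/\ H x y, H x z & y != z].
Proof.
move=> k3 [f f_inj fH]; have k2 := ltnW k3; have k1 := ltnW k2.
exists (f (Ordinal k2)), (f (Ordinal k1)), (f (Ordinal k3)).
by split; [apply: fH | apply: fH | rewrite (inj_eq f_inj)].
Qed.

Lemma arrows_paths n m N : 3 <= n <= m -> 4 < N -> m + n./2 - 1 <= N ->
  arrows (path_graphs [tuple 3; n; m]) N.
Proof.
move=> nm N5 szN H [total disj].
pose i0 : 'I_3 := @Ordinal 3 0 isT; pose i1 : 'I_3 := @Ordinal 3 1 isT.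
pose i2 : 'I_3 := @Ordinal 3 2 isT.
have [g3|nog] := has_pathP (H i0) 3.
  by exists i0; apply: (@has_copy_path _ (H i0) 3).
have col : matching_coloring (H i1) (H i2) (H i0).
  split; try exact: adj_sym.
    move=> x y xy; have [[i Hi] Hxy] := (total x y).1 xy.
    case: i Hi Hxy => [|[|[|]]] // Hi Hxy; apply/or3P.
    - by constructor 3; have -> : i0 = Ordinal Hi by apply: val_inj.
    - by constructor 1; have -> : i1 = Ordinal Hi by apply: val_inj.
    - by constructor 2; have -> : i2 = Ordinal Hi by apply: val_inj.
  move=> x y z xy xz; apply: (unique_neighbor (@adj_sym _ (H i0)) nog _ _ xy xz).
    by apply: contraTneq xy => ->; rewrite adj_irrefl.
  by apply: contraTneq xz => ->; rewrite adj_irrefl.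
have [||p|p] := @ramsey_path_upper _ _ _ _ n m col nm; rewrite ?card_ord //.
  by exists i1; apply: (@has_copy_path _ (H i1) n).
by exists i2; apply: (@has_copy_path _ (H i2) m).
Qed.

Section OfColoring.
Variables (M : nat) (c : 'I_M -> 'I_M -> 'I_3).
Hypothesis cC : forall x y, c x y = c y x.
Definition color_class (i : 'I_3) : rel 'I_M := fun x y => (x != y) && (c x y == i).

Lemma color_class_sym i : symmetric (color_class i).
Proof. by move=> x y; rewrite /color_class eq_sym cC. Qed.

Lemma color_class_irrefl i : irreflexive (color_class i).
Proof. by move=> x; rewrite /color_class eqxx. Qed.

Definition color_graph i := SGraph (@color_class_sym i) (@color_class_irrefl i).

Lemma color_graph_partition : edge_partition (complete_graph M) color_graph.
Proof.
split=> [x y|i j x y /andP[_ /eqP <-] /andP[_ /eqP //]].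
split=> [xy|[i /andP[]] //]; exists (c x y); apply/andP; split=> //; exact: eqxx.
Qed.
End OfColoring.

Definition color0 : 'I_3 := @Ordinal 3 0 isT.
Definition color1 : 'I_3 := @Ordinal 3 1 isT.
Definition color2 : 'I_3 := @Ordinal 3 2 isT.

(** For M <= 4 the sums 1 or 5, 2 or 4, and 3 of two distinct vertices of
    {0, 1, 2, 3} are the three perfect matchings of K_4. *)
Lemma arrows_paths_gt4 n m M : 3 <= n -> 3 <= m ->
  arrows (path_graphs [tuple 3; n; m]) M -> 4 < M.
Proof.
move=> n3 m3 arr; rewrite ltnNge; apply/negP => M4.
pose c (x y : 'I_M) : 'I_3 :=
  if (x + y == 1) || (x + y == 5) then color0 else
  if (x + y == 2) || (x + y == 4) then color1 else color2.
have cC x y : c x y = c y x by rewrite /c addnC.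
have [i cp] := arr _ (color_graph_partition cC).
have : exists x y z, [/\ color_graph cC i x y, color_graph cC i x z & y != z].
  by move: cp; case: i => [[|[|[|]]]] //= Hi cp; apply: has_copy_path3 cp.
case=> x [y [z [/andP[xy /eqP <-] /andP[xz cxz] yz]]].
move: cxz xy xz yz; rewrite -!(inj_eq val_inj) /c /=.
have := (ltn_ord x, ltn_ord y, ltn_ord z); move: (val x) (val y) (val z) => a b d.
case=> [[aM bM] dM].
by (case: ifP => ?; last case: ifP => ?); (case: ifP => ?; last case: ifP => ?) => //= *; lia.
Qed.

(** Red edges are those that meet the first n/2 - 1 vertices.  A red P_n would
    contain n/2 disjoint edges, each with a vertex of this set; a blue P_m
    lies in the complement, which has fewer than m vertices. *)
Lemma arrows_paths_ge n m M : 3 <= n -> 3 <= m ->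
  arrows (path_graphs [tuple 3; n; m]) M -> m + n./2 - 1 <= M.
Proof.
move=> n3 m3 arr; rewrite leqNgt; apply/negP => ltM; set b := n./2 in ltM.
have b0 : 0 < b by rewrite /b; lia.
pose c (x y : 'I_M) := if (x < b.-1) || (y < b.-1) then color1 else color2.
have cC x y : c x y = c y x by rewrite /c orbC.
have [[i lti] cp] := arr _ (color_graph_partition cC).
move: cp; case: i lti => [|[|[|]]] // lti cp.
- have [x [y [z [/andP[_]]]]] := has_copy_path3 (isT : 2 < 3) cp.
  by rewrite /c; case: ifP.
- case: cp => f f_inj fH; rewrite /= [tnth _ _]/= in f f_inj fH.
  have lt0 (k : 'I_b) : k.*2 < n by have := ltn_ord k; rewrite /b; lia.
  have lt1 (k : 'I_b) : k.*2.+1 < n by have := ltn_ord k; rewrite /b; lia.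
  pose g (k : 'I_b) := if f (Ordinal (lt0 k)) < b.-1 then Ordinal (lt0 k) else Ordinal (lt1 k).
  have g_small k : f (g k) < b.-1.
    rewrite /g; case: ifP => // big.
    have adj_f : consecutive (Ordinal (lt0 k)) (Ordinal (lt1 k)).
      by rewrite /consecutive /= eqxx.
    by have /andP[_] := fH _ _ adj_f; rewrite /c big /=; case: ifP.
  have /leq_card : injective (fun k => Ordinal (g_small k)).
    move=> k l [] /val_inj/f_inj; rewrite /g.
    by do 2![case: ifP => _]; case=> kl; apply: val_inj; move: kl => /=; lia.
  by rewrite !card_ord; lia.
case: cp => f f_inj fH; rewrite /= [tnth _ _]/= in f f_inj fH.
have f_big (j : 'I_m) : b.-1 <= f j.
  have [k jk] : exists k : 'I_m, path_graph m j k.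
    have [j0|j0] := posnP j.
      have k1 : 1 < m by lia.
      by exists (Ordinal k1); rewrite /= /consecutive /= j0.
    have k1 : j.-1 < m by have := ltn_ord j; lia.
    by exists (Ordinal k1); rewrite /= /consecutive /= prednK // eqxx orbT.
  have /andP[_] := fH j k jk; rewrite /c; case: ifP => // /norP[].
  by rewrite -leqNgt.
have lt_f (j : 'I_m) : f j - b.-1 < M - b.-1.
  by have := ltn_ord (f j); have := f_big j; lia.
have /leq_card : injective (fun j => Ordinal (lt_f j)).
  move=> j k [] fjk; apply/f_inj/val_inj; have := f_big j; have := f_big k.
  by move: fjk => /=; lia.
by rewrite !card_ord; lia.
Qed.

Theorem theorem1p1 :
  (forall n m : nat, 3 <= n -> n <= m ->
     (n, m) <> (3, 3) -> (n, m) <> (3, 4) ->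
     is_ramsey_number (path_graphs [tuple 3; n; m]) (m + n./2 - 1)) /\
  is_ramsey_number (path_graphs [tuple 3; 3; 3]) 5 /\
  is_ramsey_number (path_graphs [tuple 3; 3; 4]) 5.
Proof.
split; [move=> n m n3 nm n33 n34|split].
- have m3 := leq_trans n3 nm.
  have N5 : 4 < m + n./2 - 1.
    have [n_3|n4] : n = 3 \/ 3 < n by lia.
      have m3' : m <> 3 by move=> m_3; apply: n33; rewrite n_3 m_3.
      have m4 : m <> 4 by move=> m_4; apply: n34; rewrite n_3 m_4.
      by rewrite n_3 /=; lia.
    by lia.
  split; first by lia.
    by apply: arrows_paths; rewrite ?n3.
  by move=> M _; apply: arrows_paths_ge.
- by split=> // [|M _]; [apply: arrows_paths | apply: arrows_paths_gt4].
- by split=> // [|M _]; [apply: arrows_paths | apply: arrows_paths_gt4].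
Qed.
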